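(* If $T=[T_1,\ldots,T_n]$, $T_i\in B(\mathcal H)$, is a completely non-coisometric row contraction jointly similar to a Cuntz row isometry, then $T$ is jointly similar to the Cuntz part in the Wold decomposition of the minimal isometric dilation of $T$. Moreover, in this case, $T$ is jointly similar to the model row contraction $C=[C_1,\ldots,C_n]$, where for each $i=1,\ldots,n$, $$C_i:\overline{\Delta_{\Theta_T}(F^2(H_n)\otimes\mathcal D)}\to\overline{\Delta_{\Theta_T}(F^2(H_n)\otimes\mathcal D)}$$ is defined by $$C_i(\Delta_{\Theta_T}f):=\Delta_{\Theta_T}(S_i\otimes I_{\mathcal D})f,\qquad f\in F^2(H_n)\otimes\mathcal D,$$ and $\Delta_{\Theta_T}:=(I-\Theta_T^*\Theta_T)^{1/2}$, where $\Theta_T$ is the characteristic function of $T$.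
   Context: Conventions: $n\in\{1,2,\ldots\}$ or $n=\infty$; Hilbert spaces are complex, operators are bounded, infinite operator sums converge strongly. $H_n$ is an $n$-dimensional Hilbert space with orthonormal basis $e_1,e_2,\ldots$; $F^2(H_n)=\bigoplus_{k\ge0}H_n^{\otimes k}$ is the full Fock space ($H_n^{\otimes0}=\mathbb C1$), and $S_i\varphi=e_i\otimes\varphi$ are the left creation operators. $\mathbb F_n^+$ is the free semigroup with generators $g_1,\ldots,g_n$ and identity $g_0$; for $\alpha=g_{i_1}\cdots g_{i_k}$, $|\alpha|=k$, $e_\alpha=e_{i_1}\otimes\cdots\otimes e_{i_k}$, $T_\alpha=T_{i_1}\cdots T_{i_k}$; $|g_0|=0$, $e_{g_0}=1$, $T_{g_0}=I$. A Cuntz row isometry is $W=[W_1,\ldots,W_n]$ with $W_1,\ldots,W_n$ isometries and $\sum_iW_iW_i^*=I$. $[T_1,\ldots,T_n]$ on $\mathcal H$ is jointly similar to $[W_1,\ldots,W_n]$ on $\mathcal W$ if there is an invertible $S:\mathcal H\to\mathcal W$ with $ST_i=W_iS$ for all $i$. $T=[T_1,\ldots,T_n]$, $T_i\in B(\mathcal H)$, is a row contraction if $\sum_iT_iT_i^*\le I$; it is also regarded as an operator $\mathcal H^{(n)}=\bigoplus_{i=1}^n\mathcal H\to\mathcal H$. It is completely non-coisometric if the only $h\in\mathcal H$ with $\sum_{|\alpha|=k}\|T_\alpha^*h\|^2=\|h\|^2$ for all $k=1,2,\ldots$ is $h=0$. The minimal isometric dilation of $T$ is $V=[V_1,\ldots,V_n]$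 on $\mathcal K\supset\mathcal H$ with $V_i$ isometries with orthogonal ranges, $V_i^*|_{\mathcal H}=T_i^*$, and $\mathcal K=\bigvee_{\alpha\in\mathbb F_n^+}V_\alpha\mathcal H$ (unique up to isomorphism). In its Wold decomposition $\mathcal K=\mathcal R\oplus\mathcal R^\perp$, $\mathcal R=\bigcap_{k\ge0}\bigoplus_{|\alpha|=k}V_\alpha\mathcal K$ reduces all $V_i$, and $[V_1|_{\mathcal R},\ldots,V_n|_{\mathcal R}]$ is a Cuntz row isometry, called the Cuntz part. Put $\Delta_{T^*}=(I-\sum_iT_iT_i^* )^{1/2}$, $\Delta_T=(I-T^*T)^{1/2}$, $\mathcal D_*=\overline{\Delta_{T^*}\mathcal H}$, $\mathcal D=\overline{\Delta_T\mathcal H^{(n)}}$. The characteristic function $\Theta_T:F^2(H_n)\otimes\mathcal D\to F^2(H_n)\otimes\mathcal D_*$ is the contraction satisfying $\Theta_T(S_i\otimes I_{\mathcal D})=(S_i\otimes I_{\mathcal D_*})\Theta_T$ for all $i$ and $\Theta_T(1\otimes h)=-1\otimes\sum_iT_iP_ih+\sum_i(S_i\otimes I_{\mathcal D_*})\big(\sum_{\alpha\in\mathbb F_n^+}e_\alpha\otimes\Delta_{T^*}T_\alpha^*P_i\Delta_Th\big)$, $h\in\mathcal D$, where $P_i$ is the projection of $\mathcal H^{(n)}$ onto its $i$-th component. *)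

(* Defs.v *)
From HB Require Import structures.
From mathcomp Require Import all_boot all_order all_algebra.
From mathcomp Require Import sesquilinear.
From mathcomp Require Import finmap complex.
From mathcomp Require Import all_classical all_reals interval_inference topology normedtype.
From mathcomp.analysis.showcase Require Import summability.

Set Implicit Arguments.
Unset Strict Implicit.
Unset Printing Implicit Defensive.

Import Order.TTheory GRing.Theory Num.Theory.
Import numFieldNormedType.Exports.

Local Open Scope classical_set_scope.
Local Open Scope ring_scope.

HB.instance Definition _ (R : realType) := NormedModule.copy R[i] R[i]^o.

Section ComplexComplete.
Variable R : realType.
Implicit Types x y : R[i].

Lemma ge0_ReE x : 0 <= x -> x = (complex.Re x)%:C%C.
Proof. by case: x => a b; rewrite lecE /= => /andP[/eqP -> _]. Qed.

Lemma normC_ge_Re x : `|complex.Re x| <= complex.Re `|x|.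
Proof. by have := normc_ge_Re x; rewrite normc_def lecR. Qed.

Lemma normC_ge_Im x : `|complex.Im x| <= complex.Re `|x|.
Proof.
rewrite normc_def /= -sqrtr_sqr ler_wsqrtr //.
by rewrite lerDr sqr_ge0.
Qed.

Lemma normC_le_ReIm x : `|x| <= (`|complex.Re x| + `|complex.Im x|)%:C%C.
Proof.
rewrite normc_def lecR -[leRHS]ger0_norm ?addr_ge0 // -sqrtr_sqr ler_wsqrtr //.
rewrite sqrrD !real_normK ?num_real // addrAC lerDl.
by rewrite mulrn_wge0 ?mulr_ge0.
Qed.

Lemma complex_complete (F : set_system R[i]) : ProperFilter F -> cauchy F -> cvg F.
Proof.
move=> FF Fc.
have part (p : R[i] -> R) : (forall x y, `|p x - p y| <= complex.Re `|x - y|) ->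
    cvg (p x @[x --> F]).
  move=> pc; apply/cauchy_cvgP/cauchyP => _/posnumP[e].
  have /cauchyP/(_ (e%:num%:C)%C) := Fc; rewrite ltcR => /(_ (gt0 _))[x0 Fx].
  exists (p x0); suff : F (p @^-1` ball (p x0) e%:num) by [].
  apply: filterS Fx => x; rewrite -ball_normE. move=> H. rewrite /ball_ /= ltcE in H. move: H => /andP[_ /=].
  rewrite /preimage -ball_normE /=.
  exact/le_lt_trans/pc.
have /cvg_ex[a /cvgrPdist_lt Fa] := part (@complex.Re R)
  (fun x y => ltac:(rewrite -raddfB; exact: normC_ge_Re)).
have /cvg_ex[b /cvgrPdist_lt Fb] := part (@complex.Im R)
  (fun x y => ltac:(rewrite -raddfB; exact: normC_ge_Im)).
apply/cvg_ex; exists (a +i* b)%C; apply/cvgrPdist_lt => e; rewrite ltcE /= => /andP[/eqP e0 e1].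
have e2 : 0 < complex.Re e / 2 by rewrite divr_gt0.
near=> x; apply: (le_lt_trans (normC_le_ReIm _)).
rewrite ltcE /= e0 eqxx /= [ltRHS](splitr (complex.Re e)).
rewrite ltrD //; near: x; [move: (Fa _ e2)|move: (Fb _ e2)]; apply: filterS => x; by case: x.
Unshelve. all: by end_near. Qed.

HB.instance Definition _ := Uniform_isComplete.Build R[i] complex_complete.
End ComplexComplete.

#[global] Existing Instance totally_filter.

Lemma partial_sumE (I : choiceType) (V : zmodType) (x : I -> V) A :
  partial_sum x A = \sum_(i <- A) x i.
Proof. by rewrite /partial_sum -(big_seq_fsetE _ _ xpredT). Qed.

Lemma sum_fsetD (I : choiceType) (V : zmodType) (x : I -> V) (A B : {fset I}) :
  (A `<=` B)%fset ->
  \sum_(i <- B) x i = \sum_(i <- A) x i + \sum_(i <- (B `\` A)%fset) x i.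
Proof.
move=> AB; rewrite (big_fsetID _ (mem A)) /=; congr (_ + _); apply: eq_fbigl => i.
  by rewrite !inE /= -in_fsetI (fsetIidPr AB).
by rewrite !inE /= andbC.
Qed.

Section AbsSummable.
Variables (R : realType) (I : choiceType) (V : completeNormedModType R[i]).

Lemma cvg_partial_sum (x : I -> V) (M : R[i]) :
  (forall A : {fset I}, \sum_(i <- A) `|x i| <= M) ->
  cvg (partial_sum x @ totally).
Proof.
move=> xM; pose N (A : {fset I}) := complex.Re (\sum_(i <- A) `|x i|).
have sup_N : has_sup (range N).
  split; first by exists (N fset0), fset0.
  by exists (complex.Re M) => _ [A _ <-]; have := xM A; rewrite lecE => /andP[].
apply/cauchy_cvgP/cauchyP => e; rewrite ltcE /= => /andP[/eqP e0 e1].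
have [_ [A _ <-] NA] := sup_adherent e1 sup_N.
exists (partial_sum x A); exists A => // B /= AB.
rewrite /preimage -ball_normE /= !partial_sumE.
rewrite (sum_fsetD _ AB) opprD addNKr normrN; apply: le_lt_trans (ler_norm_sum _ _ _) _.
have s0 : 0 <= \sum_(i <- (B `\` A)%fset) `|x i| by rewrite sumr_ge0.
rewrite (ge0_ReE s0) ltcE e0 eqxx /=.
have : N B <= sup (range N) by apply: sup_upper_bound => //; exists B.
rewrite /N (sum_fsetD _ AB) raddfD /= -/(N A) => NB.
move: NA; rewrite ltrBlDr => NA; have := le_lt_trans NB NA.
by rewrite ltrD2l.
Qed.
End AbsSummable.

(* The inner product is linear in its first argument; norms take their values
   in R[i], as for every normedModType over R[i]. *)
HB.mixin Record NormedModule_isHilbert (R : realType) T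
    & CompleteNormedModule R[i] T := {
  hdot : {dot T for Num.conj} ;
  hdot_norm : forall x : T, hdot x x = `|x| ^+ 2 }.

#[short(type="hilbertType")]
HB.structure Definition Hilbert (R : realType) :=
  {T of CompleteNormedModule R[i] T & NormedModule_isHilbert R T}.

Arguments hdot {R s}.
Notation "''[' x , y ]" := (hdot x y) (format "''[' x ,  y ]") : ring_scope.

Section Dot.
Variables (R : realType) (V : lmodType R[i]) (d : {dot V for Num.conj}).
Implicit Types (x y : V) (a : R[i]).

Lemma dot_conj x y : d x y = (d y x)^*.
Proof. by rewrite {1}(hermC d) /= expr0 mul1r. Qed.
Lemma dot_ge0 x : 0 <= d x x.
Proof.
have [->|x0] := eqVneq x 0; first by rewrite linear0l.
exact/ltW/neq0_dnorm_gt0.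
Qed.
Lemma dot_eq0 x : d x x = 0 -> x = 0.
Proof.
by have [//|/(@neq0_dnorm_gt0 _ _ _ d)] := eqVneq x 0; rewrite lt0r => /andP[/eqP].
Qed.

Lemma dot_CS x y : `|d x y| ^+ 2 <= d x x * d y y.
Proof.
have [->|y0] := eqVneq y 0; first by rewrite !linear0r normr0 expr0n mulr0.
have dy : 0 < d y y by exact: neq0_dnorm_gt0.
pose a := d x y / d y y.
have ac : a^* = (d x y)^* / d y y by rewrite rmorphM fmorphV /= -(dot_conj y y).
have := dot_ge0 (x - a *: y).
rewrite linearBl !linearBr /= !linearZl_LR /= !linearZr_LR /= ac.
rewrite (dot_conj y x) /a.
rewrite divfK ?gt_eqF // subrr subr0 normCK mulrAC subr_ge0.
by rewrite ler_pdivrMr // mulrC.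
Qed.

Definition dnorm x : R[i] := sqrtC (d x x).

Lemma dnorm_sqr x : dnorm x ^+ 2 = d x x. Proof. exact: sqrtCK. Qed.

Lemma dnorm_ge0 x : 0 <= dnorm x. Proof. by rewrite sqrtC_ge0 dot_ge0. Qed.

Lemma dnormZ a x : dnorm (a *: x) = `|a| * dnorm x.
Proof.
apply: (pexpIrn (n := 2)); rewrite ?nnegrE ?mulr_ge0 ?dnorm_ge0 //.
by rewrite exprMn !dnorm_sqr linearZl_LR /= linearZr_LR /= normCK mulrA.
Qed.

Lemma dnorm_eq0 x : dnorm x = 0 -> x = 0.
Proof. by move=> /eqP; rewrite sqrtC_eq0 => /eqP/dot_eq0. Qed.

Lemma dnormCS x y : `|d x y| <= dnorm x * dnorm y.
Proof.
rewrite -(ler_pXn2r (n := 2)) ?nnegrE ?mulr_ge0 ?dnorm_ge0 //.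
by rewrite exprMn !dnorm_sqr dot_CS.
Qed.

Lemma dnormD x y : dnorm (x + y) <= dnorm x + dnorm y.
Proof.
rewrite -(ler_pXn2r (n := 2)) ?nnegrE ?addr_ge0 ?dnorm_ge0 //.
rewrite dnorm_sqr linearDl !linearDr /= sqrrD !dnorm_sqr (dot_conj y x).
rewrite [leRHS]addrAC [X in _ + X <= _]addrC addrACA lerD2l.
have z_real : d x y + (d x y)^* \is Num.real by rewrite CrealE rmorphD /= conjCK addrC.
apply: (le_trans (real_ler_norm z_real)); apply: (le_trans (ler_normD _ _)).
by rewrite norm_conjC -mulr2n ler_wMn2r // dnormCS.
Qed.

End Dot.

Section HdotTheory.
Variables (R : realType) (H : hilbertType R).
Implicit Types x y : H.

Lemma hdot_dnorm x : `|x| = dnorm (@hdot R H) x.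
Proof.
by apply: (pexpIrn (n := 2)); rewrite ?nnegrE ?dnorm_ge0 // dnorm_sqr hdot_norm.
Qed.

Lemma hdot_CS x y : `|'[x, y]| <= `|x| * `|y|.
Proof. by rewrite !hdot_dnorm dnormCS. Qed.

End HdotTheory.

Section CDot.
Variable R : realType.

Definition Cdot (x y : R[i]) : R[i] := x * y^*.

Lemma Cdot_bilinear : bilinear_for
  (GRing.Scale.Law.clone _ _ ( *%R) _) (GRing.Scale.Law.clone _ _ (Num.conj \; *%R) _) Cdot.
Proof.
split=> u a x y; rewrite /Cdot /=.
  by rewrite mulrDl -mulrA.
by rewrite rmorphD rmorphM mulrDr mulrCA.
Qed.
HB.instance Definition _ := bilinear_isBilinear.Build _ _ _ _ _ _ Cdot Cdot_bilinear.

Lemma Cdot_herm x y : Cdot x y = (-1) ^+ false * (Cdot y x)^*.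
Proof. by rewrite /Cdot expr0 mul1r rmorphM /= conjCK mulrC. Qed.
HB.instance Definition _ := isHermitianSesquilinear.Build _ _ _ _ Cdot Cdot_herm.

Lemma Cdot_gt0 (u : R[i]) : u != 0 -> 0 < Cdot u u.
Proof. by move=> u0; rewrite /Cdot -normCK exprn_gt0 // normr_gt0. Qed.
HB.instance Definition _ := isDotProduct.Build _ _ Cdot Cdot_gt0.

Lemma Cdot_norm (x : R[i]) : Cdot x x = `|x| ^+ 2. Proof. by rewrite normCK. Qed.
HB.instance Definition _ := NormedModule_isHilbert.Build R R[i] Cdot_norm.
End CDot.

Section L2.
Variables (R : realType) (I : choiceType) (E : hilbertType R).
Implicit Types (f g : I -> E) (A : {fset I}).

(* [l2 I E] is the Hilbert space direct sum of copies of E indexed by I, of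
   arbitrary cardinality: sums are limits along the finite subsets of I. *)
Definition sq_summable : {pred I -> E} := fun f =>
  `[< exists M : R[i], forall A : {fset I}, \sum_(i <- A) `|f i| ^+ 2 <= M >].

Record l2 := L2 { l2_val :> I -> E; _ : l2_val \in sq_summable }.

HB.instance Definition _ := [isSub for l2_val].
HB.instance Definition _ := [Choice of l2 by <:].

Lemma sq_summable_submod : submod_closed sq_summable.
Proof.
split=> [|a f g]; first by apply/asboolP; exists 0 => A; rewrite big1 // => i; rewrite normr0 expr0n.
move=> /asboolP[M fM] /asboolP[N gN]; apply/asboolP.
exists ((`|a| ^+ 2 * M + N) *+ 2) => A.
apply: (@le_trans _ _ (\sum_(i <- A) (`|a| ^+ 2 * `|f i| ^+ 2 + `|g i| ^+ 2) *+ 2)).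
  apply: ler_sum => i _; rewrite -exprMn -normrZ.
  apply: (@le_trans _ _ ((`|a *: f i| + `|g i|) ^+ 2)).
    by rewrite ler_pXn2r ?nnegrE ?addr_ge0 // ler_normD.
  rewrite sqrrD addrAC [leRHS]mulr2n lerD2l.
  have r : `|a *: f i| - `|g i| \is Num.real by rewrite realB.
  have := real_exprn_even_ge0 (n := 2) r isT.
  by rewrite sqrrB addrAC subr_ge0.
rewrite sumrMnl lerMn2r /= big_split /= -mulr_sumr.
by rewrite lerD ?ler_wpM2l ?exprn_ge0.
Qed.
HB.instance Definition _ := GRing.isSubmodClosed.Build R[i] (I -> E) sq_summable sq_summable_submod.
HB.instance Definition _ := [SubChoice_isSubLmodule of l2 by <:].

Lemma l2P (x y : l2) : (forall i, x i = y i) -> x = y.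
Proof. by move=> xy; apply/val_inj/funext. Qed.
Lemma l2DE (x y : l2) i : (x + y) i = x i + y i. Proof. by []. Qed.
Lemma l2ZE a (x : l2) i : (a *: x) i = a *: x i. Proof. by []. Qed.
Lemma l2NE (x : l2) i : (- x) i = - x i. Proof. by []. Qed.
Lemma l20E i : (0 : l2) i = 0. Proof. by []. Qed.

Definition l2_dot (x y : l2) : R[i] := summability.sum (fun i => '[x i, y i]).

Lemma l2_dot_cvg (x y : l2) :
  partial_sum (fun i => '[x i, y i]) @ totally --> l2_dot x y.
Proof.
have [/asboolP[M xM] /asboolP[N yN]] := (valP x, valP y).
apply: (@cvg_partial_sum _ _ R[i] _ (M + N)) => A.
apply: (@le_trans _ _ (\sum_(i <- A) (`|x i| ^+ 2 + `|y i| ^+ 2))); last first.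
  by rewrite big_split lerD.
apply: ler_sum => i _; apply: (le_trans (hdot_CS _ _)).
have r : `|x i| - `|y i| \is Num.real by rewrite realB.
have := real_exprn_even_ge0 (n := 2) r isT.
rewrite sqrrB addrAC subr_ge0; apply: le_trans.
by rewrite mulr2n lerDl mulr_ge0.
Qed.

Lemma l2_dot_eq (x y : l2) (l : R[i]) :
  partial_sum (fun i => '[x i, y i]) @ totally --> l -> l2_dot x y = l.
Proof. by move=> /cvg_lim; apply; exact: norm_hausdorff. Qed.

Lemma l2_dot_bilinear : bilinear_for
  (GRing.Scale.Law.clone _ _ ( *%R) _)
  (GRing.Scale.Law.clone _ _ (Num.conj \; *%R) _) l2_dot.
Proof.
split=> u a x y /=; apply/l2_dot_eq.
  rewrite [X in X @ _](_ : _ = (fun A => a * partial_sum (fun i => '[x i, u i]) A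
    + partial_sum (fun i => '[y i, u i]) A)).
    exact: (cvgD (cvgZl_tmp (k := a) (@l2_dot_cvg x u)) (@l2_dot_cvg y u)).
  apply/funext => A; rewrite !partial_sumE mulr_sumr -big_split /=.
  by apply: eq_bigr => i _; rewrite linearDl /= linearZl_LR.
rewrite [X in X @ _](_ : _ = (fun A => a^* * partial_sum (fun i => '[u i, x i]) A
    + partial_sum (fun i => '[u i, y i]) A)).
  exact: (cvgD (cvgZl_tmp (k := a^*) (@l2_dot_cvg u x)) (@l2_dot_cvg u y)).
apply/funext => A; rewrite !partial_sumE mulr_sumr -big_split /=.
by apply: eq_bigr => i _; rewrite linearDr /= linearZr_LR.
Qed.
HB.instance Definition _ := bilinear_isBilinear.Build _ _ _ _ _ _ l2_dot l2_dot_bilinear.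

Lemma cvg_conjC (T : Type) (F : set_system T) {FF : Filter F} (h : T -> R[i]) (l : R[i]) :
  h @ F --> l -> (fun t => (h t)^*) @ F --> l^*.
Proof.
move=> /cvgrPdist_lt hl; apply/cvgrPdist_lt => e e0.
by apply: filterS (hl e e0) => t; rewrite -rmorphB norm_conjC.
Qed.

Lemma cvg_seq_sum (T : Type) (J : Type) (F : set_system T) {FF : Filter F}
    (V : normedModType R[i]) (r : seq J) (h : J -> T -> V) (l : J -> V) :
  (forall j, h j @ F --> l j) ->
  (fun t => \sum_(j <- r) h j t) @ F --> \sum_(j <- r) l j.
Proof.
move=> hl; elim: r => [|j r IH].
  by rewrite big_nil; under eq_fun do rewrite big_nil; exact: cvg_cst.
by rewrite big_cons; under eq_fun do rewrite big_cons; exact: (cvgD (hl j) IH).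
Qed.

Lemma l2_dot_herm x y : l2_dot x y = (-1) ^+ false * (l2_dot y x)^*.
Proof.
rewrite expr0 mul1r; apply/l2_dot_eq.
rewrite [X in X @ _](_ : _ = (fun A => (partial_sum (fun i => '[y i, x i]) A)^*)).
  exact: (cvg_conjC (@l2_dot_cvg y x)).
apply/funext => A; rewrite !partial_sumE rmorph_sum /=.
by apply: eq_bigr => i _; rewrite dot_conj.
Qed.
HB.instance Definition _ := isHermitianSesquilinear.Build _ _ _ _ l2_dot l2_dot_herm.

Lemma ge0_closed (c : R[i]) : closed [set z : R[i] | c <= z].
Proof.
move=> z clz.
have close (e : R) : 0 < e -> exists2 w, c <= w & complex.Re `|z - w| < e.
  move=> e0; have /clz[w [cw]] : nbhs z (ball z e%:C%C).
    by apply: nbhsx_ballx; rewrite ltcR.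
  rewrite -ball_normE /ball_ /= => zw; exists w => //.
  by move: zw; rewrite ltcE => /andP[].
rewrite /= lecE; apply/andP; split.
  rewrite -subr_eq0 -normr_le0; apply/ler_addgt0Pl => e /close[w].
  rewrite addr0 lecE => /andP[/eqP <- _]; rewrite -raddfB => zw.
  exact: le_trans (normC_ge_Im _) (ltW zw).
apply/ler_addgt0Pl => e /close[w]; rewrite lecE => /andP[_ cw] zw.
apply: (le_trans cw); rewrite -lerBlDr -raddfB.
apply: (le_trans (ler_norm _)); rewrite -normrN -raddfN opprB.
exact: le_trans (normC_ge_Re _) (ltW zw).
Qed.

Lemma partial_sum_dot (x : l2) A :
  partial_sum (fun i => '[x i, x i]) A = \sum_(i <- A) `|x i| ^+ 2.
Proof. by rewrite partial_sumE; apply: eq_bigr => i _; rewrite hdot_norm. Qed.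

Lemma l2_partial_le (x : l2) A : \sum_(i <- A) `|x i| ^+ 2 <= l2_dot x x.
Proof.
apply: (@closed_cvg _ _ _ _ _ _ (ge0_closed (c := _))) (@l2_dot_cvg x x).
exists A => // B /= AB; rewrite partial_sum_dot (sum_fsetD _ AB).
by rewrite lerDl sumr_ge0 // => i _; rewrite exprn_ge0.
Qed.

Lemma l2_dot_le (x : l2) M :
  (forall A, \sum_(i <- A) `|x i| ^+ 2 <= M) -> l2_dot x x <= M.
Proof.
move=> xM; rewrite -lerN2.
have xN : (fun A => - partial_sum (fun i => '[x i, x i]) A) @ totally --> - l2_dot x x.
  exact: (cvgN (@l2_dot_cvg x x)).
apply: (@closed_cvg _ _ _ _ _ _ (ge0_closed (c := _))) xN.
by exists fset0 => // B _ /=; rewrite lerN2 partial_sum_dot.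
Qed.

Lemma l2_dot_gt0 (u : l2) : u != 0 -> 0 < l2_dot u u.
Proof.
move=> u0; have [i ui] : exists i, u i != 0.
  apply: contrapT => /forallNP n; case/eqP: u0; apply: l2P => i.
  by apply: contrapT => /eqP/n.
apply: (@lt_le_trans _ _ (`|u i| ^+ 2)); first by rewrite exprn_gt0 ?normr_gt0.
by have := l2_partial_le u [fset i]%fset; rewrite big_seq_fset1.
Qed.
HB.instance Definition _ := isDotProduct.Build _ _ l2_dot l2_dot_gt0.

HB.instance Definition _ := Lmodule_isNormed.Build R[i] l2
  (dnormD l2_dot) (dnormZ l2_dot) (@dnorm_eq0 _ _ l2_dot).

Lemma l2_dot_norm (x : l2) : l2_dot x x = `|x| ^+ 2.
Proof. by rewrite -dnorm_sqr. Qed.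

Lemma l2_norm_le (x : l2) i : `|x i| <= `|x|.
Proof.
rewrite -(ler_pXn2r (n := 2)) ?nnegrE // -l2_dot_norm.
by have := l2_partial_le x [fset i]%fset; rewrite big_seq_fset1.
Qed.

Lemma l2_complete (F : set_system l2) : ProperFilter F -> cauchy F -> cvg F.
Proof.
move=> FF Fc.
have coord i : cvg ((x : l2) i @[x --> F]).
  apply/cauchy_cvgP/cauchyP => e e0.
  have /cauchyP/(_ e e0)[x0 Fx] := Fc; exists (x0 i).
  suff : F ((fun x : l2 => x i) @^-1` ball (x0 i) e) by [].
  apply: filterS Fx => x; rewrite /preimage -!ball_normE /ball_ /=.
  exact/le_lt_trans/(l2_norm_le (x0 - x)).
pose g i := lim ((x : l2) i @[x --> F]).
have Fg i : (x : l2) i @[x --> F] --> g i by exact: coord.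
have bound (x : l2) (e : R[i]) : 0 < e -> F [set y | `|x - y| <= e] ->
    forall A : {fset I}, \sum_(i <- A) `|x i - g i| ^+ 2 <= e ^+ 2.
  move=> e0 Fx A.
  have lim_sum : (fun y : l2 => - \sum_(i <- A) `|x i - y i| ^+ 2) @ F -->
      - \sum_(i <- A) `|x i - g i| ^+ 2.
    apply: (cvgN (V := R[i])); apply: (cvg_seq_sum (V := R[i])) => i.
    under eq_fun do rewrite expr2.
    have nc : (fun y : l2 => `|x i - y i|) @ F --> `|x i - g i|.
      by apply: cvg_norm; apply: cvgB => //; exact: cvg_cst.
    exact: cvgM.
  rewrite -lerN2.
  apply: (@closed_cvg _ _ _ _ _ _ (ge0_closed (c := _))) lim_sum.
  apply: filterS Fx => y /= xy; rewrite lerN2.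
  apply: (@le_trans _ _ (l2_dot (x - y) (x - y))); first exact: (l2_partial_le (x - y)).
  by rewrite l2_dot_norm ler_pXn2r ?nnegrE // ltW.
have near_pt (e : R[i]) : 0 < e -> exists2 x : l2, F (ball x e) & F [set y | `|x - y| <= e].
  move=> e0; have /cauchyP/(_ e e0)[x0 Fx] := Fc; exists x0 => //.
  by apply: filterS Fx => x; rewrite -ball_normE /ball_ /= => /ltW.
have g_in : g \in sq_summable.
  have [x _ Fx] := near_pt 1 ltr01.
  have xg : (fun i => x i - g i) \in sq_summable.
    by apply/asboolP; exists (1 ^+ 2); exact: bound.
  have -> : g = val x - (fun i => x i - g i).
    by apply/funext => i; rewrite !fctE opprB addrC subrK.
  by rewrite rpredB //; exact: valP.
apply/cvg_ex; exists (L2 g_in); apply/cvgrPdist_le => e e0.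
have e2 : 0 < e / 2 by rewrite divr_gt0.
have [x _ Fx] := near_pt _ e2.
apply: filterS (Fx) => y /= xy.
have xg : `|x - L2 g_in| <= e / 2.
  rewrite -(ler_pXn2r (n := 2)) ?nnegrE ?(ltW e2) //.
  have : l2_dot (x - L2 g_in) (x - L2 g_in) <= (e / 2) ^+ 2.
    by apply: l2_dot_le; exact: bound.
  by rewrite l2_dot_norm.
rewrite -(subrKA x) (le_trans (ler_normD _ _)) // [leRHS]splitr lerD //.
by rewrite distrC.
Qed.
HB.instance Definition _ := Uniform_isComplete.Build l2 l2_complete.
HB.instance Definition _ := NormedModule_isHilbert.Build R l2 l2_dot_norm.
End L2.

Section Subspace.
Variables (R : realType) (H : hilbertType R).

(* A closed linear subspace M, and [sub_of M], M itself as a Hilbert space. *)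
Record subspace := Subspace {
  sub_set :> set H ;
  sub_closed : closed sub_set ;
  sub_submod : submod_closed [pred x | x \in sub_set] }.

Record sub_of (M : subspace) := SubOf { sub_val :> H ; _ : sub_val \in (M : set H) }.

Variable M : subspace.

Definition sub_pred : {pred H} := [pred x | x \in (M : set H)].
HB.instance Definition _ := GRing.isSubmodClosed.Build R[i] H sub_pred (sub_submod M).

HB.instance Definition _ := [isSub of sub_of M for @sub_val M].
HB.instance Definition _ := [Choice of sub_of M by <:].
HB.instance Definition _ :=
  GRing.SubChoice_isSubLmodule.Build R[i] H sub_pred (sub_of M) (sub_submod M).

Definition sub_norm (x : sub_of M) : R[i] := `|sub_val x|.

Lemma sub_normD x y : sub_norm (x + y) <= sub_norm x + sub_norm y.
Proof. exact: ler_normD. Qed.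
Lemma sub_normZ a x : sub_norm (a *: x) = `|a| * sub_norm x.
Proof. exact: normrZ. Qed.
Lemma sub_norm0 x : sub_norm x = 0 -> x = 0.
Proof. by move=> /normr0_eq0 x0; exact: val_inj. Qed.
HB.instance Definition _ := Lmodule_isNormed.Build R[i] (sub_of M)
  sub_normD sub_normZ sub_norm0.

Lemma sub_complete (F : set_system (sub_of M)) : ProperFilter F -> cauchy F -> cvg F.
Proof.
move=> FF Fc.
have /cvg_ex[l Fl] : cvg (sub_val x @[x --> F]).
  apply/cauchy_cvgP/cauchyP => e e0.
  have /cauchyP/(_ e e0)[x0 Fx] := Fc; exists (x0 : H).
  suff : F ((fun x : sub_of M => x : H) @^-1` ball (x0 : H) e) by [].
  by apply: filterS Fx => x; rewrite /preimage -!ball_normE /ball_ /=.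
have Ml : l \in (M : set H).
  apply/mem_set; apply: (@closed_cvg _ _ F _ (@sub_val M) _ (@sub_closed M) _ l) => //.
  by near=> x; apply/set_mem; exact: (valP x).
apply/cvg_ex; exists (SubOf Ml); apply/cvgrPdist_lt => e e0.
by move/cvgrPdist_lt : Fl => /(_ e e0).
Unshelve. all: by end_near. Qed.
HB.instance Definition _ := Uniform_isComplete.Build (sub_of M) sub_complete.

Definition sub_dot (x y : sub_of M) : R[i] := '[sub_val x, sub_val y].

Lemma sub_dot_bilinear : bilinear_for
  (GRing.Scale.Law.clone _ _ ( *%R) _)
  (GRing.Scale.Law.clone _ _ (Num.conj \; *%R) _) sub_dot.
Proof.
split=> u a x y; rewrite /sub_dot /=.
  by rewrite linearDl /= linearZl_LR.
by rewrite linearDr /= linearZr_LR.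
Qed.
HB.instance Definition _ :=
  bilinear_isBilinear.Build _ _ _ _ _ _ sub_dot sub_dot_bilinear.

Lemma sub_dot_herm x y : sub_dot x y = (-1) ^+ false * (sub_dot y x)^*.
Proof. exact: hermC. Qed.
HB.instance Definition _ := isHermitianSesquilinear.Build _ _ _ _ sub_dot sub_dot_herm.

Lemma sub_dot_norm (x : sub_of M) : sub_dot x x = `|x| ^+ 2.
Proof. exact: hdot_norm. Qed.

Lemma sub_dot_gt0 (u : sub_of M) : u != 0 -> 0 < sub_dot u u.
Proof. by move=> u0; rewrite sub_dot_norm exprn_gt0 ?normr_gt0. Qed.
HB.instance Definition _ := isDotProduct.Build _ _ sub_dot sub_dot_gt0.
HB.instance Definition _ := NormedModule_isHilbert.Build R (sub_of M) sub_dot_norm.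

End Subspace.

HB.mixin Record isBounded (R : realType) (H K : hilbertType R) (f : H -> K) := {
  bounded_subproof : exists M : R[i], forall x, `|f x| <= M * `|x| }.

#[short(type="bounded_op")]
HB.structure Definition Bounded (R : realType) (H K : hilbertType R) :=
  {f of isBounded R H K f & @GRing.Linear R[i] H K *:%R f}.

Notation "{ 'bounded' H -> K }" := (bounded_op H K)
  (at level 0, H at level 98, K at level 99, format "{ 'bounded'  H  ->  K }").

Section Ops.
Variables (R : realType) (H K L : hilbertType R).

Lemma null_fun_bounded : exists M : R[i], forall x, `|\0 x : K| <= M * `|x : H|.
Proof. by exists 0 => x; rewrite normr0 mul0r. Qed.
HB.instance Definition _ := isBounded.Build R H K \0 null_fun_bounded.

Lemma closure_normP (A : set H) x :
  closure A x <-> forall e : R[i], 0 < e -> exists2 y, A y & `|x - y| < e.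
Proof.
split=> [clx e e0|clx B].
  by have [] := clx _ (nbhsx_ballx x e e0) => y; rewrite -ball_normE => -[]; exists y.
rewrite -nbhs_ballE => -[e /= e0 eB]; have [y Ay xy] := clx _ e0.
by exists y; split=> //; apply: eB; rewrite -ball_normE.
Qed.

Lemma closure_submod (A : set H) :
  submod_closed [pred x | x \in A] -> submod_closed [pred x | x \in closure A].
Proof.
move=> [A0 AD]; split=> [|a x y].
  by apply/mem_set/subset_closure/set_mem.
move=> /set_mem/closure_normP xA /set_mem/closure_normP yA; apply/mem_set/closure_normP => e e0.
have a0 : 0 < `|a| + 1 by rewrite ltr_wpDl.
have [x' Ax xx'] := xA (e / 2 / (`|a| + 1)) (divr_gt0 (divr_gt0 e0 (ltr0Sn _ 1)) a0).
have [y' Ay yy'] := yA (e / 2) (divr_gt0 e0 (ltr0Sn _ 1)).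
exists (a *: x' + y'); first by apply/set_mem/AD; apply/mem_set.
rewrite opprD addrACA -scalerBr (le_lt_trans (ler_normD _ _)) // normrZ [ltRHS]splitr.
rewrite ler_ltD // (@le_trans _ _ ((`|a| + 1) * `|x - x'|)) //.
  by rewrite ler_wpM2r // lerDl.
by rewrite mulrC -ler_pdivlMr // ltW.
Qed.

End Ops.

Section ClosedRange.
Variables (R : realType) (H K : hilbertType R).
Variable f : {bounded H -> K}.

Lemma range_submod : submod_closed [pred y | y \in range f].
Proof.
split=> [|a x y]; first by apply/mem_set; exists 0; rewrite ?linear0.
move=> /set_mem[u _ <-] /set_mem[v _ <-]; apply/mem_set.
by exists (a *: u + v) => //; rewrite linearP.
Qed.

(* The closure of the range of f; [to_range x] is f x as an element of it. *)
Definition cl_range : subspace K :=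
  Subspace (@closed_closure _ (range f)) (closure_submod range_submod).

Definition to_range (x : H) : sub_of cl_range :=
  @SubOf _ _ cl_range (f x) (mem_set (subset_closure (imageT f x))).

End ClosedRange.

Section Bigcap.
Variables (R : realType) (H : hilbertType R).

Lemma bigcap_submod (I : Type) (P : set I) (M : I -> subspace H) :
  submod_closed [pred x | x \in \bigcap_(i in P) (M i : set H)].
Proof.
split=> [|a x y].
  by apply/mem_set => i _; apply/set_mem/(sub_submod (M i)).1.
move=> /set_mem xM /set_mem yM; apply/mem_set => i Pi; apply/set_mem.
by apply: (sub_submod (M i)).2; apply/mem_set; [exact: xM|exact: yM].
Qed.

Definition bigcap_sub (I : Type) (P : set I) (M : I -> subspace H) : subspace H :=
  Subspace (closed_bigI (fun i _ => @sub_closed _ _ (M i)))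
    (bigcap_submod P M).

(* The closed linear span of A, as the smallest closed subspace containing A. *)
Definition clspan (A : set H) : subspace H :=
  bigcap_sub [set M : subspace H | A `<=` M] id.

End Bigcap.

Section Tensor.
Variables (R : realType) (I : choiceType).
Implicit Types E : hilbertType R.

Lemma l2_single_in E (i : I) (x : E) :
  (fun j => if j == i then x else 0) \in @sq_summable R I E.
Proof.
apply/asboolP; exists (`|x| ^+ 2) => A; have [iA|iA] := boolP (i \in A).
  rewrite (big_fsetD1 i) //= eqxx big_seq big1 ?addr0 // => j.
  by rewrite !inE => /andP[/negPf -> _]; rewrite normr0 expr0n.
rewrite big_seq big1 ?exprn_ge0 // => j jA.
by rewrite ifN ?normr0 ?expr0n //; apply: contra iA => /eqP <-.
Qed.

(* For a Hilbert space E, l2 I C (x) E = l2 I E, with (f (x) y)_i = f_i y.  The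
   lemmas [tens_dot] and [tens_basis_cvg] show that [tens] is indeed a Hilbert
   space tensor product: inner products multiply, and elementary tensors are
   total. *)
Definition l2_basis (i : I) : l2 I R[i] := L2 (l2_single_in i (1 : R[i])).

Lemma tens_in E (f : l2 I R[i]) (x : E) : (fun i => f i *: x) \in @sq_summable R I E.
Proof.
have /asboolP[M fM] := valP f; apply/asboolP; exists (M * `|x| ^+ 2) => A.
under eq_bigr do rewrite normrZ exprMn.
by rewrite -mulr_suml ler_wpM2r ?exprn_ge0.
Qed.

Definition tens E (f : l2 I R[i]) (x : E) : l2 I E := L2 (tens_in f x).

Lemma tens_dot E f g (x y : E) : '[tens f x, tens g y] = '[f, g] * '[x, y].
Proof.
apply/l2_dot_eq; rewrite [X in X @ _](_ : _ =
    (fun A => partial_sum (fun i => '[f i, g i]) A * '[x, y])).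
  exact: (cvgMr_tmp (@l2_dot_cvg _ _ _ f g)).
apply/funext => A; rewrite !partial_sumE mulr_suml; apply: eq_bigr => i _.
by rewrite linearZl_LR /= linearZr_LR /= mulrA.
Qed.

Lemma tens_basisE E i (x : E) j : tens (l2_basis i) x j = if j == i then x else 0.
Proof. by rewrite /=; case: eqP; rewrite (scale1r, scale0r). Qed.

Lemma l2_sumE E (x : I -> l2 I E) (A : {fset I}) j :
  (\sum_(i <- A) x i) j = \sum_(i <- A) x i j.
Proof. by rewrite -[LHS]/(val _ j) raddf_sum fct_sumE. Qed.

Lemma tens_basis_cvg E (x : l2 I E) :
  partial_sum (fun i => tens (l2_basis i) (x i)) @ totally --> x.
Proof.
have xN := @l2_dot_cvg _ _ _ x x.
apply/cvgrPdist_lt => e e0.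
have e2 : 0 < e ^+ 2 by rewrite exprn_gt0.
have [A _ AB] := (cvgrPdist_lt _ _).1 xN _ e2.
exists A => // B /AB /=; rewrite partial_sum_dot => H.
rewrite -(ltr_pXn2r (n := 2)) ?nnegrE ?(ltW e0) //.
have dE j : (x - partial_sum (fun i => tens (l2_basis i) (x i)) B) j =
    if j \in B then 0 else x j.
  rewrite l2DE l2NE partial_sumE l2_sumE; case: ifPn => jB.
    rewrite (big_fsetD1 j) //= eqxx scale1r big_seq big1 ?addr0 ?subrr // => k.
    by rewrite !inE eq_sym => /andP[/negPf -> _]; rewrite scale0r.
  rewrite big_seq big1 ?subr0 // => k kB /=.
  by rewrite ifN ?scale0r //; apply: contra jB => /eqP ->.
apply: le_lt_trans H.
rewrite -l2_dot_norm ger0_norm; last first.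
  by rewrite subr_ge0 l2_partial_le.
apply: l2_dot_le => C; rewrite lerBrDl.
apply: le_trans (l2_partial_le x (B `|` C)%fset).
rewrite [leRHS](sum_fsetD _ (fsubsetUl B C)) lerD2l.
apply: (@le_trans _ _ (\sum_(i <- (B `|` C)%fset)
    `|(x - partial_sum (fun i => tens (l2_basis i) (x i)) B) i| ^+ 2)).
  rewrite [leRHS](sum_fsetD _ (fsubsetUr B C)) lerDl.
  by apply: sumr_ge0 => k _; rewrite exprn_ge0.
rewrite (sum_fsetD _ (fsubsetUl B C)) big_seq big1 ?add0r => [|k kB].
  by apply: ler_sum => k _; rewrite dE; case: ifP; rewrite // normr0 expr0n exprn_ge0.
by rewrite dE kB normr0 expr0n.
Qed.

End Tensor.
Arguments l2_basis {R I}.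

Section Fock.
Variables (R : realType) (I : choiceType).
Implicit Types E : hilbertType R.

(* Words over I are sequences, [::] being the empty word.  With I indexing an
   orthonormal basis (e_i) of H_n, the vectors e_w, w a word of length k, form an
   orthonormal basis of the k-th tensor power of H_n, so that F^2(H_n) is
   l2 (seq I) C, with e_w = l2_basis w, and F^2(H_n) (x) E is l2 (seq I) E. *)
Definition fock E := l2 (seq I) E.

Definition creat_fun E (i : I) (x : fock E) : seq I -> E :=
  fun w => if w is j :: v then (if j == i then x v else 0) else 0.

Lemma creat_in E i (x : fock E) : creat_fun i x \in @sq_summable R (seq I) E.
Proof.
have /asboolP[M xM] := valP x; apply/asboolP; exists M => A.
pose F w := `|creat_fun i x w| ^+ 2.
pose C := [fset i :: v | v in [fset behead w | w in A]]%fset.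
have -> : \sum_(w <- A) F w = \sum_(w <- (A `&` C)%fset) F w.
  rewrite (sum_fsetD F (fsubsetIl A C)) [X in _ + X]big_seq [X in _ + X]big1 ?addr0 // => w.
  rewrite !inE => /andP[+ wA]; rewrite wA /= => wC.
  case: w wA wC => [|j v] wA wC; first by rewrite /F /= normr0 expr0n.
  rewrite /F /=; case: eqP => [ji|_]; last by rewrite normr0 expr0n.
  case/negP: wC; apply/imfsetP; exists v => /=; last by rewrite ji.
  by apply/imfsetP; exists (j :: v).
apply: (@le_trans _ _ (\sum_(w <- C) F w)).
  rewrite [leRHS](sum_fsetD F (fsubsetIr A C)) lerDl.
  by apply: sumr_ge0 => w _; rewrite /F exprn_ge0.
rewrite big_imfset => [|u v _ _ []] //=.
by rewrite /F /=; under eq_bigr do rewrite eqxx.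
Qed.

(* S_i (x) I_E on F^2(H_n) (x) E; for E = C this is S_i itself, see
   [creat_basis] and [creat_tens]. *)
Definition creat E i (x : fock E) : fock E := L2 (creat_in i x).

Lemma creat_tens E i (f : fock R[i]) (x : E) : creat i (tens f x) = tens (creat i f) x.
Proof.
apply: l2P => -[|j v] /=; first by rewrite scale0r.
by case: eqP => // _; rewrite scale0r.
Qed.

Lemma creat_basis i w : creat i (l2_basis w : fock R[i]) = l2_basis (i :: w).
Proof.
by apply: l2P => -[|j v] //=; rewrite eqseq_cons; case: eqP.
Qed.

(* The inclusion of F^2(H_n) (x) M in F^2(H_n) (x) H. *)
Definition fock_incl (H : hilbertType R) (M : subspace H) (x : fock (sub_of M)) : fock H :=
  L2 (valP x : (fun w => (x w : H)) \in @sq_summable R (seq I) H).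
End Fock.

Section Operators.
Variable R : realType.
Implicit Types H K : hilbertType R.

(* The Hilbert space adjoint; for a bounded f the vector z exists and is unique
   by the Riesz representation theorem. *)
Definition adj H K (f : H -> K) : K -> H :=
  fun y => get [set z : H | forall x, '[f x, y] = '[x, z]].

Definition op_ge0 H (A : H -> H) : Prop := forall x, 0 <= '[A x, x].

Definition op_le H (A B : H -> H) : Prop := op_ge0 (fun x => B x - A x).

Definition is_sqrt H (A : H -> H) (B : {bounded H -> H}) : Prop :=
  op_ge0 B /\ forall x, B (B x) = A x.

(* The positive square root, which exists and is unique when A is bounded and
   positive; the default value is irrelevant for such A. *)
Definition op_sqrt H (A : H -> H) : {bounded H -> H} :=
  if pselect (exists B, is_sqrt A B) is left h then projT1 (cid h) else \0.

(* Strongly convergent sum of operators. *)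
Definition op_sum (I : choiceType) H K (F : I -> H -> K) : H -> K :=
  fun x => summability.sum (F^~ x).

Definition op_summable (I : choiceType) H K (F : I -> H -> K) : Prop :=
  forall x, cvg (partial_sum (F^~ x) @ totally).

End Operators.

(* Indices of the generators: n = Some m stands for the integer m, n = None for
   n = infinity. *)
Definition gen (n : option nat) : choiceType :=
  if n is Some m then 'I_m : choiceType else nat : choiceType.

Section Tuples.
Variables (R : realType) (n : option nat).
Implicit Types H K : hilbertType R.

Definition optuple H := gen n -> {bounded H -> H}.

Definition opword H (T : optuple H) (w : seq (gen n)) : H -> H :=
  foldr (fun i f => T i \o f) idfun w.

Definition TTstar H (T : optuple H) (i : gen n) : H -> H := T i \o adj (T i).

Definition row_contraction H (T : optuple H) : Prop :=
  op_summable (TTstar T) /\ op_le (op_sum (TTstar T)) idfun.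

Definition isometry_op H K (f : H -> K) : Prop := forall x, `|f x| = `|x|.

Definition cuntz_row_isometry H (W : optuple H) : Prop :=
  [/\ forall i, isometry_op (W i),
      op_summable (TTstar W) &
      op_sum (TTstar W) =1 idfun].

Definition jointly_similar H K (T : optuple H) (W : optuple K) : Prop :=
  exists (S : {bounded H -> K}) (S' : {bounded K -> H}),
    [/\ cancel S S', cancel S' S & forall i x, S (T i x) = W i (S x)].

Definition completely_non_coisometric H (T : optuple H) : Prop :=
  forall h : H,
    (forall k, (0 < k)%N ->
       partial_sum (fun w : k.-tuple (gen n) => `|adj (opword T w) h| ^+ 2)
         @ totally --> `|h| ^+ 2) ->
    h = 0.

(* The inclusion of H in K is the isometry J. *)
Definition minimal_isometric_dilation H (T : optuple H)
    K (J : {bounded H -> K}) (V : optuple K) : Prop :=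
  [/\ isometry_op J,
      forall i, isometry_op (V i),
      forall i j, i != j -> forall x y, '[V i x, V j y] = 0,
      forall i h, adj (V i) (J h) = J (adj (T i) h) &
      clspan (\bigcup_w range (fun h => opword V w (J h))) = setT :> set K].

(* The ranges V_w K, w of length k, are pairwise orthogonal and closed, so their
   Hilbert space direct sum is the closed span of their union. *)
Definition cuntz_space K (V : optuple K) : subspace K :=
  bigcap_sub setT (fun k : nat =>
    clspan (\bigcup_(w in [set w : seq (gen n) | size w = k])
              range (opword V w))).

Definition is_cuntz_part K (V : optuple K)
    (U : optuple (sub_of (cuntz_space V))) : Prop :=
  forall i x, U i x = V i x :> K.

(* T as an operator from H^(n) = l2 (gen n) H to H; the projection P_i of H^(n)
   onto its i-th component is x |-> x i. *)
Definition row_op H (T : optuple H) : l2 (gen n) H -> H :=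
  fun x => summability.sum (fun i => T i (x i)).

Definition defect_star H (T : optuple H) : {bounded H -> H} :=
  op_sqrt (fun h => h - op_sum (TTstar T) h).

Definition defect H (T : optuple H) : {bounded l2 (gen n) H -> l2 (gen n) H} :=
  op_sqrt (fun x => x - adj (row_op T) (row_op T x)).

Definition defect_star_space H (T : optuple H) := sub_of (cl_range (defect_star T)).
Definition defect_space H (T : optuple H) := sub_of (cl_range (defect T)).

(* The equation for Theta (1 (x) h), an identity in F^2(H_n) (x) D_*, is written
   in the larger space F^2(H_n) (x) H. *)
Definition is_char_fun H (T : optuple H)
    (Theta : {bounded fock (gen n) (defect_space T) ->
                      fock (gen n) (defect_star_space T)}) : Prop :=
  [/\ forall x, `|Theta x| <= `|x|,
      forall i x, Theta (creat i x) = creat i (Theta x) &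
      forall h : defect_space T,
        fock_incl (Theta (tens (l2_basis [::]) h)) =
          - tens (l2_basis [::]) (row_op T (\val h))
          + summability.sum (fun i => creat i (summability.sum (fun w =>
              tens (l2_basis w)
                (defect_star T (adj (opword T w) (defect T (\val h) i))))))].

Definition defect_op H K (Theta : {bounded H -> K}) : {bounded H -> H} :=
  op_sqrt (fun x => x - adj Theta (Theta x)).

Definition is_model H K (Theta : {bounded fock (gen n) H -> fock (gen n) K})
    (C : optuple (sub_of (cl_range (defect_op Theta)))) : Prop :=
  forall i f, C i (to_range (defect_op Theta) f) =
              to_range (defect_op Theta) (creat i f).

End Tuples.

(* Main.v *)
From Pilot Require Import Defs.
From HB Require Import structures.
From mathcomp Require Import all_boot all_order all_algebra.
From mathcomp Require Import sesquilinear finmap complex ring lra.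
From mathcomp Require Import all_classical all_reals interval_inference.
From mathcomp Require Import topology normedtype sequences.
From mathcomp.analysis.showcase Require Import summability.

Import Pilot.Defs.

Set Implicit Arguments.
Unset Strict Implicit.
Unset Printing Implicit Defensive.

Import Order.TTheory GRing.Theory Num.Theory.
Import numFieldNormedType.Exports.

Local Open Scope classical_set_scope.
Local Open Scope ring_scope.

(** Let S be a similarity of T with a Cuntz row isometry A, let V on K be a
    minimal isometric dilation of T, and write U on R for its Cuntz part.  The
    compression Y of R to H satisfies Y U_i = T_i Y, so T is similar to U once Y
    is invertible.

    The operator Z = S Y intertwines the Cuntz row isometries U and A, and then
    its adjoint intertwines them as well.  So the kernel of Y reduces U, hence V,
    and it is orthogonal to H; by minimality it is zero.  On the other hand Y^*,
    the projection of H to R, is bounded below.  Indeed, for each k the vectors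
    V_w J S^-1 A_w^* g, summed over the words w of length k, yield a vector in the
    closed span of the V_w K, the k-th level, which compresses to S^-1 g and
    whose norm is at most a constant times |g|.  So h = S^-1 g stays away from
    the complement of the k-th level, uniformly in k, and since the levels
    decrease to R, it stays away from the complement of R.  An operator that is
    bounded below and whose adjoint is injective is invertible; this is
    [cuntz_part_similar].

    For the model, the same result is applied to a concrete dilation on the sum
    of H and F^2 (x) D.  There the projection onto the complement of R is read off
    from the map O (h, f) = P h + Theta f, where P is the Poisson kernel of T
    with coefficients Ds T_w^* h: the isometry of the matrix built from T and its
    defect operators shows that 1 - O^* O is the projection onto R
    ([cuntz_proj_dot]).  In particular the projection of (0, f) to R has square
    norm |f|^2 - |Theta f|^2, which is the square norm of Delta f, where Delta is
    the defect operator of Theta.  These projections are dense in R, because a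
    vector of R orthogonal to all of them lies in H, and T is completely
    non-coisometric ([cuntz_proj_fock_dense]).  Hence the assignment of the
    projection of (0, f) to Delta f extends to a unitary operator, and it carries
    the creation operators, as they act on the model space, to the Cuntz part.

    The Hilbert space theory behind this is developed first: orthogonal
    projections, adjoints, positive square roots (obtained by iteration, which
    also gives T D = Ds T for the defect operators D and Ds of T), and the row and
    column operators of a possibly infinite family. *)

(** * Real-valued norms and completeness *)

Section RealNorm.
Variables (R : realType) (V : normedModType R[i]).
Implicit Types (x y : V).

(** Norms in a module over R[i] have values in R[i], whose order is partial; the
    estimates below are carried out with this real-valued form of the norm. *)
Definition nr x : R := complex.Re `|x|.

Lemma nrE x : `|x| = (nr x)%:C%C.
Proof. exact: ge0_ReE. Qed.

Lemma nr_ge0 x : 0 <= nr x.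
Proof. by have := normr_ge0 x; rewrite nrE lecR. Qed.

Lemma nrD x y : nr (x + y) <= nr x + nr y.
Proof. by have := ler_normD x y; rewrite !nrE -raddfD lecR. Qed.

Lemma nrN x : nr (- x) = nr x. Proof. by rewrite /nr normrN. Qed.

Lemma nrB x y : nr (x - y) = nr (y - x). Proof. by rewrite -nrN opprB. Qed.

Lemma nr0 : nr (0 : V) = 0. Proof. by rewrite /nr normr0. Qed.

Lemma nr_triangle x y z : nr (x - z) <= nr (x - y) + nr (y - z).
Proof. by rewrite -(subrKA y x); exact: nrD. Qed.

Lemma nr_eq0 x : nr x <= 0 -> x = 0.
Proof.
by move=> x0; apply/normr0_eq0; rewrite nrE; congr (_%:C%C); apply/le_anti; rewrite x0 nr_ge0.
Qed.

Lemma nrZ (a : R[i]) x : nr (a *: x) = complex.Re `|a| * nr x.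
Proof.
have -> : nr (a *: x) = complex.Re ((complex.Re `|a|)%:C%C * (nr x)%:C%C).
  by rewrite -nrE -ge0_ReE // -normrZ.
by rewrite /= mul0r subr0.
Qed.

Lemma nr_eps_eq x y : (forall e : R, 0 < e -> nr (x - y) <= e) -> x = y.
Proof.
move=> h; apply/subr0_eq/nr_eq0/ler_addgt0Pr => e e0; rewrite add0r; exact: h.
Qed.

End RealNorm.

Section Cauchy.
Variables (R : realType) (V : completeNormedModType R[i]).

(** Closest points, preimages under operators that are bounded below and
    similar objects arise as limits of approximate solutions that come closer
    and closer to each other; this is completeness in that form. *)
Lemma shrinking_sets_limit (S : R -> set V) :
  (forall e, 0 < e -> exists x, S e x) ->
  (forall e d, e <= d -> S e `<=` S d) ->
  (forall d, 0 < d -> exists2 e, 0 < e & forall x y, S e x -> S e y -> nr (x - y) <= d) ->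
  exists l, forall e d, 0 < e -> 0 < d -> exists2 x, S e x & nr (l - x) < d.
Proof.
move=> Sn Sm Sd.
pose F : set_system V := filter_from [set e : R | 0 < e] S.
have FF : ProperFilter F.
  apply: filter_from_proper; last by move=> e /Sn[x Sx]; exists x.
  apply: filter_from_filter; first by exists 1 => /=.
  move=> e d /= e0 d0; exists (Num.min e d); first by rewrite /= lt_min e0.
  by move=> x Sx; split; apply: Sm Sx; rewrite ge_min lexx ?orbT.
have /cauchy_cvgP Fc : cauchy F.
  apply/cauchyP => e; rewrite ltcE /= => /andP[/eqP e0 e1].
  have [d d0 dS] := Sd _ (divr_gt0 e1 (ltr0Sn _ 1)).
  have [x Sx] := Sn _ d0; exists x; exists d => // y Sy.
  rewrite -ball_normE /ball_ /= nrE ltcE /= -e0 eqxx /=.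
  by apply: le_lt_trans (dS _ _ Sx Sy) _; rewrite ltr_pdivrMr // ltr_pMr // ltrDl.
exists (lim F) => e d e0 d0.
have : F (ball (lim F) d%:C%C) by apply/Fc/nbhsx_ballx; rewrite ltcR.
move=> [e' /= e'0 e'S].
have [x Sx] := Sn (Num.min e e') ltac:(by rewrite lt_min e0).
exists x; first by apply: Sm Sx; rewrite ge_min lexx.
have /e'S : S e' x by apply: Sm Sx; rewrite ge_min lexx orbT.
by rewrite -ball_normE /ball_ /= nrE ltcR.
Qed.

End Cauchy.

Section HilbertNorm.
Variables (R : realType) (H : hilbertType R).
Implicit Types (x y z : H).

Lemma hdot_nr x : '[x, x] = (nr x ^+ 2)%:C%C.
Proof. by rewrite hdot_norm nrE -rmorphXn. Qed.

Lemma hdotC x y : '[x, y] = ('[y, x])^*. Proof. exact: dot_conj. Qed.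

Lemma hdot_eq0 x : '[x, x] = 0 -> x = 0. Proof. exact: dot_eq0. Qed.

Lemma hdotDl x y z : '[x + y, z] = '[x, z] + '[y, z]. Proof. by rewrite linearDl. Qed.
Lemma hdotDr x y z : '[x, y + z] = '[x, y] + '[x, z]. Proof. by rewrite linearDr. Qed.
Lemma hdotBl x y z : '[x - y, z] = '[x, z] - '[y, z]. Proof. by rewrite linearBl. Qed.
Lemma hdotBr x y z : '[x, y - z] = '[x, y] - '[x, z]. Proof. by rewrite linearBr. Qed.
Lemma hdotZl a x y : '[a *: x, y] = a * '[x, y]. Proof. by rewrite linearZl_LR. Qed.
Lemma hdotZr a x y : '[x, a *: y] = a^* * '[x, y]. Proof. by rewrite linearZr_LR. Qed.
Lemma hdot0l x : '[0, x] = 0. Proof. by rewrite linear0l. Qed.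
Lemma hdot0r x : '[x, 0] = 0. Proof. by rewrite linear0r. Qed.

Lemma nr_CS x y : complex.Re `|'[x, y]| <= nr x * nr y.
Proof. by have := hdot_CS x y; rewrite !nrE -rmorphM lecR. Qed.

Lemma hdot_inj x y : (forall z, '[x, z] = '[y, z]) -> x = y.
Proof. by move=> h; apply/subr0_eq/hdot_eq0; rewrite hdotBl h subrr. Qed.

Lemma nr_sqrD x y : nr (x + y) ^+ 2 = nr x ^+ 2 + nr y ^+ 2 + 2 * complex.Re '[x, y].
Proof.
have : '[x + y, x + y] = '[x, x] + '[y, y] + ('[x, y] + ('[x, y])^*).
  by rewrite hdotDl !hdotDr -(hdotC y x) addrACA [in LHS]addrC; ring.
by rewrite !hdot_nr => /(congr1 (@complex.Re R)); case: ('[x, y]) => a b /= ->; ring.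
Qed.

Lemma nr_sqrB x y : nr (x - y) ^+ 2 = nr x ^+ 2 + nr y ^+ 2 - 2 * complex.Re '[x, y].
Proof. by rewrite nr_sqrD nrN linearNr raddfN mulrN. Qed.

Lemma parallelogram x y :
  nr (x + y) ^+ 2 + nr (x - y) ^+ 2 = 2 * nr x ^+ 2 + 2 * nr y ^+ 2.
Proof. by rewrite nr_sqrD nr_sqrB; ring. Qed.

Lemma nr_le_sqr (K : hilbertType R) x (y : K) : nr x ^+ 2 <= nr y ^+ 2 -> nr x <= nr y.
Proof. by rewrite ler_pXn2r ?nnegrE ?nr_ge0. Qed.

End HilbertNorm.

(** * Orthogonal projections, the Riesz theorem and adjoints *)

Section Projection.
Variables (R : realType) (H : hilbertType R) (M : subspace H).
Implicit Types (x y z : H).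

Lemma subspaceD a x y : (M : set H) x -> (M : set H) y -> (M : set H) (a *: x + y).
Proof. by move=> Mx My; apply/set_mem/(sub_submod M).2; exact/mem_set. Qed.

Lemma subspace0 : (M : set H) 0.
Proof. by apply/set_mem/(sub_submod M).1. Qed.

Lemma subspaceZ a x : (M : set H) x -> (M : set H) (a *: x).
Proof. by move=> Mx; rewrite -[_ *: _]addr0; apply: subspaceD => //; exact: subspace0. Qed.

Lemma subspace_closed x :
  (forall e : R, 0 < e -> exists2 y, (M : set H) y & nr (x - y) < e) -> (M : set H) x.
Proof.
move=> h; apply: (@sub_closed _ _ M); apply/closure_normP => e.
rewrite ltcE /= => /andP[/eqP e0 /h[y My xy]]; exists y => //.
by rewrite nrE ltcE /= -e0 eqxx.
Qed.

(** Almost closest points are close to each other by the parallelogram law. *)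
Lemma closest_point x :
  exists2 m, (M : set H) m & forall z, (M : set H) z -> nr (x - m) <= nr (x - z).
Proof.
pose D : set R := [set nr (x - z) ^+ 2 | z in (M : set H)].
have D_inf : has_inf D.
  split; first by exists (nr (x - 0) ^+ 2), 0 => //; exact: subspace0.
  by exists 0 => _ [z _ <-]; exact: sqr_ge0.
pose d := inf D.
have dle z : (M : set H) z -> d <= nr (x - z) ^+ 2.
  by move=> Mz; apply: ge_inf; [exact: D_inf.2|exists z].
pose S (e : R) := [set z | (M : set H) z /\ nr (x - z) ^+ 2 <= d + e].
have [||e e0|l lS] := @shrinking_sets_limit R H S.
- move=> e e0; have [_ [z Mz <-] zd] := inf_adherent e0 D_inf.
  by exists z; split=> //; exact: ltW.
- by move=> e e' ee' z [Mz zd]; split=> //; apply: le_trans zd _; rewrite lerD2l.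
(* By the parallelogram law, 4 times this excess bounds the square distance. *)
- exists (e ^+ 2 / 4); first by rewrite divr_gt0 ?exprn_gt0.
  move=> y z [My yd] [Mz zd].
  have mid : (M : set H) (2^-1 *: (y + z)).
    by apply: subspaceZ; rewrite -[y]scale1r; exact: subspaceD.
  have := parallelogram (x - y) (x - z).
  have -> : x - y - (x - z) = z - y by rewrite opprB addrC subrKA.
  have -> : x - y + (x - z) = 2 *: (x - 2^-1 *: (y + z)).
    by rewrite scalerBr scalerA divff ?pnatr_eq0 // scale1r scaler_nat mulr2n opprD addrACA.
  rewrite nrZ (_ : complex.Re `|2 : R[i]| = 2); last first.
    by rewrite ger0_norm.
  have := dle _ mid; rewrite -!(nrB y z) => ds eq4.
  have: nr (y - z) ^+ 2 <= e ^+ 2.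
    by move: eq4 yd zd ds; rewrite exprMn; lra.
  by rewrite ler_pXn2r ?nnegrE ?nr_ge0 ?(ltW e0).
exists l.
  by apply: subspace_closed => e e0; have [y [My _]] := lS 1 e ltr01 e0; exists y.
move=> z Mz; apply/ler_addgt0Pr => e e0.
have s0 : 0 < e ^+ 2 / 4 by rewrite divr_gt0 ?exprn_gt0.
have [y [My yd] ly] := lS _ (e / 2) s0 (divr_gt0 e0 (ltr0Sn _ 1)).
have yz : nr (x - y) <= nr (x - z) + e / 2.
  rewrite -(ler_pXn2r (n := 2)) ?nnegrE ?addr_ge0 ?nr_ge0 ?divr_ge0 ?(ltW e0) //.
  apply: le_trans yd _; have := dle _ Mz; have := nr_ge0 (x - z).
  have -> : (nr (x - z) + e / 2) ^+ 2 = nr (x - z) ^+ 2 + e ^+ 2 / 4 + nr (x - z) * e.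
    by field.
  move=> n0 dz; have ne0 : 0 <= nr (x - z) * e by rewrite mulr_ge0 ?(ltW e0).
  lra.
by have := nr_triangle x y l; rewrite (nrB y l); lra.
Qed.

(** If x - m had a nonzero component along some z in M, then moving m by that
    component would bring it closer to x. *)
Lemma projection_exists x :
  exists2 m, (M : set H) m & forall z, (M : set H) z -> '[x - m, z] = 0.
Proof.
have [m Mm mle] := closest_point x; exists m => // z Mz.
have [->|z0] := eqVneq z 0; first by rewrite hdot0r.
set u := x - m; have zz : '[z, z] != 0 by apply: contra z0 => /eqP/hdot_eq0 ->.
pose a := '[u, z] / '[z, z].
have := mle (a *: z + m) (subspaceD _ Mz Mm).
rewrite (addrC _ m) opprD addrA -/u => le1; clearbody u.
have uz : '[u - a *: z, a *: z] = 0.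
  by rewrite hdotZr hdotBl hdotZl divfK // subrr mulr0.
have : nr u ^+ 2 = nr (u - a *: z) ^+ 2 + nr (a *: z) ^+ 2.
  by rewrite -[in LHS](subrK (a *: z) u) (nr_sqrD (u - a *: z)) uz /= mulr0 addr0.
move=> eq1.
have l2 : nr u ^+ 2 <= nr (u - a *: z) ^+ 2 by rewrite ler_pXn2r ?nnegrE ?nr_ge0.
have az : nr (a *: z) <= 0.
  rewrite -(ler_pXn2r (n := 2)) ?nnegrE ?nr_ge0 // expr0n /=.
  by move: eq1 l2; lra.
move/nr_eq0: az => /eqP; rewrite scaler_eq0 (negPf z0) orbF mulf_eq0 invr_eq0 (negPf zz) orbF.
by move/eqP.
Qed.

(** The difference of x and its projection is orthogonal to M, hence to x. *)
Lemma bipolar x :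
  (forall z, (forall y, (M : set H) y -> '[y, z] = 0) -> '[x, z] = 0) -> (M : set H) x.
Proof.
move=> h; have [m Mm mo] := projection_exists x.
suff -> : x = m by [].
have o1 : '[x, x - m] = 0.
  by apply: h => y My; rewrite hdotC mo // conjC0.
apply/subr0_eq/hdot_eq0; rewrite hdotBl o1 hdotC mo // conjC0 subrr //.
Qed.

End Projection.

Section BoundedOperators.
Variables (R : realType).
Implicit Types (H K L : hilbertType R).

Lemma boundedP H K (f : {bounded H -> K}) :
  exists2 M : R, 0 < M & forall x, nr (f x) <= M * nr x.
Proof.
have [M fM] := @bounded_subproof R H K f.
exists (1 + `|complex.Re M|) => [|x]; first by rewrite ltr_pwDl.
have := fM x; rewrite !nrE lecE => /andP[_]; case: M {fM} => a b /=.
rewrite mulr0 subr0 => h; apply: le_trans h _.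
by rewrite ler_wpM2r ?nr_ge0 // ler_wpDl // ler_norm.
Qed.

Lemma nr_bound H K (f : H -> K) (M : R) :
  (forall x, nr (f x) <= M * nr x) -> exists M : R[i], forall x, `|f x| <= M * `|x|.
Proof. by move=> fM; exists M%:C%C => x; rewrite !nrE -rmorphM lecR. Qed.

Definition bounded_of H K (f : H -> K) (M : R) (lf : linear f)
    (bf : forall x, nr (f x) <= M * nr x) : {bounded H -> K} :=
  let l := GRing.isLinear.Build R[i] H K _ f lf in
  let b := isBounded.Build R H K f (nr_bound bf) in
  HB.pack f l b.

Lemma comp_bounded H K L (f : {bounded K -> L}) (g : {bounded H -> K}) :
  exists M : R[i], forall x, `|(f \o g) x| <= M * `|x|.
Proof.
have [M M0 fM] := boundedP f; have [N N0 gN] := boundedP g.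
apply: (@nr_bound _ _ _ (M * N)) => x /=; apply: le_trans (fM _) _.
by rewrite -mulrA ler_wpM2l // ltW.
Qed.
HB.instance Definition _ H K L (f : {bounded K -> L}) (g : {bounded H -> K}) :=
  isBounded.Build R H L (f \o g) (comp_bounded f g).

Lemma add_bounded H K (f g : {bounded H -> K}) :
  exists M : R[i], forall x, `|(f \+ g) x| <= M * `|x|.
Proof.
have [M M0 fM] := boundedP f; have [N N0 gN] := boundedP g.
apply: (@nr_bound _ _ _ (M + N)) => x /=; apply: le_trans (nrD _ _) _.
by rewrite mulrDl lerD.
Qed.
HB.instance Definition _ H K (f g : {bounded H -> K}) :=
  isBounded.Build R H K (f \+ g) (add_bounded f g).

Lemma sub_bounded H K (f g : {bounded H -> K}) :
  exists M : R[i], forall x, `|(f \- g) x| <= M * `|x|.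
Proof.
have [M M0 fM] := boundedP f; have [N N0 gN] := boundedP g.
apply: (@nr_bound _ _ _ (M + N)) => x /=; apply: le_trans (nrD _ _) _.
by rewrite mulrDl nrN lerD.
Qed.
HB.instance Definition _ H K (f g : {bounded H -> K}) :=
  isBounded.Build R H K (f \- g) (sub_bounded f g).

Lemma id_bounded H : exists M : R[i], forall x, `|(idfun : H -> H) x| <= M * `|x|.
Proof. by exists 1 => x; rewrite mul1r. Qed.
HB.instance Definition _ H := isBounded.Build R H H idfun (id_bounded H).

Lemma sub_val_linear H (M : subspace H) : linear (@sub_val R H M).
Proof. by []. Qed.

Lemma sub_val_nr H (M : subspace H) (x : sub_of M) : nr (sub_val x) <= 1 * nr x.
Proof. by rewrite mul1r. Qed.

Definition incl H (M : subspace H) : {bounded sub_of M -> H} :=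
  bounded_of (@sub_val_linear H M) (@sub_val_nr H M).

Lemma dotl_linear H (y : H) : linear (fun x => '[x, y]).
Proof. by move=> a u v; rewrite hdotDl hdotZl. Qed.

Definition dotl H (y : H) : {bounded H -> R[i]} :=
  @bounded_of H R[i] (fun x => '[x, y]) (nr y) (dotl_linear y)
    (fun x => ltac:(rewrite mulrC; exact: nr_CS)).

Lemma hdot_suml H (y : H) J (r : seq J) (F : J -> H) :
  '[\sum_(j <- r) F j, y] = \sum_(j <- r) '[F j, y].
Proof. exact: (raddf_sum (dotl y)). Qed.

Lemma bounded_cvg H K (f : {bounded H -> K}) T (F : set_system T) {FF : Filter F}
    (h : T -> H) (l : H) :
  h @ F --> l -> (fun t => f (h t)) @ F --> f l.
Proof.
move=> hl; have [M M0 fM] := boundedP f.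
apply/cvgrPdist_lt => e; rewrite ltcE /= => /andP[/eqP e0 e1].
have e2 : 0 < (complex.Re e / M)%:C%C by rewrite ltcR divr_gt0.
apply: filterS ((cvgrPdist_lt _ _).1 hl _ e2) => t.
rewrite !nrE ltcR -raddfB => lt1.
rewrite ltcE /= -e0 eqxx /=; apply: le_lt_trans (fM _) _.
by rewrite mulrC -ltr_pdivlMr.
Qed.


Lemma hdot_cvg H (y : H) T (F : set_system T) {FF : Filter F} (h : T -> H) (l : H) :
  h @ F --> l -> (fun t => '[h t, y]) @ F --> '[l, y].
Proof. by move=> hl; have := @bounded_cvg H R[i] (dotl y) T F FF h l hl. Qed.

(** Norms of an R[i]-module are complex, but closures only have to be tested on
    real radii. *)
Lemma subspace_of_closed H (A : set H) :
  (forall x, (forall e : R, 0 < e -> exists2 y, A y & nr (x - y) < e) -> A x) -> closed A.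
Proof.
move=> Ac x /closure_normP clx; apply: Ac => e e0.
have [|y Ay] := clx e%:C%C; first by rewrite ltcR.
by rewrite nrE ltcR; exists y.
Qed.

Lemma subspace_of_submod H (A : set H) :
  A 0 -> (forall a x y, A x -> A y -> A (a *: x + y)) -> submod_closed [pred x | x \in A].
Proof.
move=> A0 AD; split=> [|a x y]; first exact/mem_set.
by move=> /set_mem Ax /set_mem Ay; apply/mem_set/AD.
Qed.

Definition subspace_of H (A : set H) A0 AD Ac : subspace H :=
  Subspace (@subspace_of_closed H A Ac) (@subspace_of_submod H A A0 AD).

Lemma ker_0 H K (f : {bounded H -> K}) : f 0 = 0. Proof. exact: linear0. Qed.

Lemma kerD H K (f : {bounded H -> K}) a x y :
  f x = 0 -> f y = 0 -> f (a *: x + y) = 0.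
Proof. by move=> fx fy; rewrite linearP /= fx fy scaler0 addr0. Qed.

Lemma ker_closed H K (f : {bounded H -> K}) x :
  (forall e : R, 0 < e -> exists2 y, f y = 0 & nr (x - y) < e) -> f x = 0.
Proof.
move=> h; have [M M0 fM] := boundedP f; apply: nr_eps_eq => e e0; rewrite subr0.
have [y fy xy] := h (e / M) (divr_gt0 e0 M0).
rewrite -[f x]subr0 -fy -raddfB; apply: le_trans (fM _) _.
by rewrite mulrC -ler_pdivlMr // ltW.
Qed.

Definition ker_subspace H K (f : {bounded H -> K}) : subspace H :=
  @subspace_of H [set x | f x = 0] (ker_0 f) (@kerD H K f) (@ker_closed H K f).

Lemma preimD H K (f : {bounded H -> K}) (M : subspace K) a x y :
  (M : set K) (f x) -> (M : set K) (f y) -> (M : set K) (f (a *: x + y)).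
Proof. by move=> fx fy; rewrite linearP /=; exact: subspaceD. Qed.

Lemma preim0 H K (f : {bounded H -> K}) (M : subspace K) : (M : set K) (f 0).
Proof. by rewrite linear0; exact: subspace0. Qed.

Lemma preim_closed H K (f : {bounded H -> K}) (M : subspace K) x :
  (forall e : R, 0 < e -> exists2 y, (M : set K) (f y) & nr (x - y) < e) ->
  (M : set K) (f x).
Proof.
move=> h; have [C C0 fC] := boundedP f; apply: subspace_closed => e e0.
have [y fy xy] := h (e / C) (divr_gt0 e0 C0).
exists (f y) => //; rewrite -raddfB; apply: le_lt_trans (fC _) _.
by rewrite mulrC -ltr_pdivlMr.
Qed.

Definition preim_subspace H K (f : {bounded H -> K}) (M : subspace K) : subspace H :=
  @subspace_of H [set x | (M : set K) (f x)] (preim0 f M) (@preimD H K f M) (@preim_closed H K f M).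

Lemma clspan_min H (A : set H) (M : subspace H) :
  A `<=` (M : set H) -> (clspan A : set H) `<=` (M : set H).
Proof. by move=> AM x; apply. Qed.

Lemma clspan_in H (A : set H) : A `<=` (clspan A : set H).
Proof. by move=> x Ax M; apply. Qed.

Lemma clspan_ortho H (A : set H) z :
  (forall a, A a -> '[a, z] = 0) -> forall x, (clspan A : set H) x -> '[x, z] = 0.
Proof. by move=> Az; apply: (clspan_min (M := ker_subspace (dotl z))). Qed.

(** A nonzero functional vanishes on a hyperplane, and a vector orthogonal to
    that hyperplane represents it after rescaling. *)
Theorem riesz H (f : {bounded H -> R[i]}) : exists z, forall x, f x = '[x, z].
Proof.
have [/= h|/existsNP[x0 fx0]] := pselect (forall x, f x = 0).
  by exists 0 => x; rewrite h hdot0r.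
have [m /= fm mo] := projection_exists (ker_subspace f) x0.
set u := x0 - m in mo; have fu : f u != 0.
  by rewrite raddfB /= fm subr0; exact/eqP.
have uu : '[u, u] != 0.
  by apply: contra fu => /eqP/hdot_eq0 ->; rewrite linear0.
exists ((f u / '[u, u])^* *: u) => x; rewrite hdotZr conjCK.
have : '[x - (f x / f u) *: u, u] = 0.
  rewrite hdotC mo ?conjC0 //=.
  by rewrite raddfB /= linearZ_LR /= /GRing.scale /= divfK // subrr.
rewrite hdotBl hdotZl => /subr0_eq ->.
by rewrite mulrC mulrACA divfK // divff // mulr1.
Qed.

Lemma adjP H K (f : {bounded H -> K}) x y : '[f x, y] = '[x, adj f y].
Proof.
have [z zP] := riesz (dotl y \o f).
have : exists z, forall x, '[f x, y] = '[x, z] by exists z => x'; exact: zP.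
by move=> ex; have := getPex ex; apply.
Qed.

Lemma adjPr H K (f : {bounded H -> K}) x y : '[y, f x] = '[adj f y, x].
Proof. by rewrite hdotC adjP -hdotC. Qed.

Lemma adj_uniq H K (f : {bounded H -> K}) y z :
  (forall x, '[f x, y] = '[x, z]) -> adj f y = z.
Proof.
by move=> h; apply: hdot_inj => x; rewrite hdotC -adjP h -hdotC.
Qed.

Lemma adj_linear H K (f : {bounded H -> K}) : linear (adj f).
Proof.
by move=> a x y; apply: adj_uniq => z; rewrite !hdotDr !hdotZr !adjP.
Qed.

Lemma adj_nr H K (f : {bounded H -> K}) (M : R) :
  0 <= M -> (forall x, nr (f x) <= M * nr x) -> forall y, nr (adj f y) <= M * nr y.
Proof.
move=> M0 fM y; have [->|a0] := eqVneq (adj f y) 0.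
  by rewrite nr0 mulr_ge0 ?nr_ge0.
have p : 0 < nr (adj f y).
  rewrite lt_def nr_ge0 andbT; apply: contra a0 => /eqP h; apply/eqP/nr_eq0; rewrite h //.
rewrite -(ler_pM2l p) -expr2.
have : complex.Re '[f (adj f y), y] <= nr (f (adj f y)) * nr y.
  by apply: le_trans (nr_CS _ _); apply: le_trans (ler_norm _) (normC_ge_Re _).
rewrite adjP hdot_nr /= => h; apply: le_trans h _.
by rewrite mulrA [nr _ * M]mulrC ler_wpM2r ?nr_ge0.
Qed.

Lemma adj_bounded H K (f : {bounded H -> K}) :
  exists M : R[i], forall y, `|adj f y| <= M * `|y|.
Proof.
have [M M0 fM] := boundedP f.
by apply: (@nr_bound _ _ _ M); apply: adj_nr => //; exact: ltW.
Qed.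

HB.instance Definition _ H K (f : {bounded H -> K}) :=
  GRing.isLinear.Build R[i] K H _ (adj f) (adj_linear f).
HB.instance Definition _ H K (f : {bounded H -> K}) :=
  isBounded.Build R K H (adj f) (adj_bounded f).

Lemma adj_comp H K L (f : {bounded K -> L}) (g : {bounded H -> K}) y :
  adj (f \o g) y = adj g (adj f y).
Proof. by apply: adj_uniq => x /=; rewrite !adjP. Qed.

Lemma adjK H K (f : {bounded H -> K}) x : adj (adj f) x = f x.
Proof. by apply: adj_uniq => y; rewrite adjPr. Qed.

(** An operator that is bounded below has closed range; so it is invertible
    as soon as nothing is orthogonal to its range. *)
Lemma bounded_below_inv H K (f : {bounded H -> K}) (c : R) :
  0 < c -> (forall x, nr x <= c * nr (f x)) ->
  (forall y, (forall x, '[f x, y] = 0) -> y = 0) ->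
  exists g : {bounded K -> H}, cancel f g /\ cancel g f.
Proof.
move=> c0 fc fd.
have [M M0 fM] := boundedP f.
have fsur y : (cl_range f : set K) y -> exists x, f x = y.
  move=> yR; have near (e : R) : 0 < e -> exists x, nr (y - f x) <= e.
    move=> e0; have /closure_normP := yR; move/(_ e%:C%C).
    by case=> [|_ [x _ <-]]; rewrite ?ltcR // nrE ltcR => /ltW; exists x.
  have [||d d0|l lS] := @shrinking_sets_limit R H (fun e : R => [set x | nr (y - f x) <= e]).
  - exact: near.
  - by move=> e e' ee' x /= /le_trans; apply.
  - exists (d / c / 2) => [|x x' /= xy xy']; first by rewrite !divr_gt0.
    apply: le_trans (fc _) _; rewrite mulrC -ler_pdivlMr // raddfB /=.
    by rewrite [leRHS]splitr; apply: le_trans (nr_triangle _ y _) _; rewrite lerD // nrB.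
  exists l; apply: nr_eps_eq => e e0.
  have [x /= yx lx] := lS (e / 2) (e / M / 2) ltac:(by rewrite divr_gt0)
    ltac:(by rewrite !divr_gt0).
  have : nr (f l - f x) <= e / 2.
    rewrite -raddfB; apply: le_trans (fM _) _.
    by rewrite mulrC -ler_pdivlMr // mulrAC ltW.
  move=> lx2; rewrite [leRHS]splitr; apply: le_trans (nr_triangle _ (f x) _) _.
  by rewrite lerD // nrB.
have fsurj y : exists x, f x = y.
  apply: fsur; apply: bipolar => z zR.
  rewrite (fd z) ?hdot0r // => x; apply: zR; exact: (set_mem (valP (to_range f x))).
have /choice[g gK] := fsurj.
have fi x y : f x = f y -> x = y.
  move=> fxy; apply/subr0_eq/nr_eq0; apply: le_trans (fc _) _.
  by rewrite raddfB /= fxy subrr nr0 mulr0.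
have gl : linear g by move=> a x y; apply: fi; rewrite linearP /= !gK.
have gb x : nr (g x) <= c * nr x by rewrite -{2}[x]gK.
by exists (bounded_of gl gb); split=> x //=; apply: fi; rewrite gK.
Qed.

End BoundedOperators.

Arguments bounded_cvg [R H K] f [T F FF h l].
Arguments hdot_cvg [R H] y [T F FF h l].

(** * Positive square roots *)

Section SquareRoot.
Variables (R : realType).
Implicit Types (H K : hilbertType R).

Lemma ge0C (z : R[i]) : z = z^* -> 0 <= complex.Re z -> 0 <= z.
Proof.
case: z => a b [] /eqP; rewrite -addr_eq0 -mulr2n mulrn_eq0 /= => /eqP -> a0.
by rewrite lecE /= eqxx.
Qed.

Lemma ge0_conj (z : R[i]) : 0 <= z -> z^* = z.
Proof. by move=> /ger0_real/CrealP. Qed.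

(** Over the complex numbers a form with real diagonal values is hermitian:
    polarize with the scalars 1 and i. *)
Lemma op_ge0_sym H (D : {bounded H -> H}) :
  op_ge0 D -> forall x y, '[D x, y] = '[x, D y].
Proof.
move=> D0 x y; set p := '[D x, y]; pose q := '[D y, x].
have E a : '[D (a *: y + x), a *: y + x] =
    a * (a^* * '[D y, y] + q) + (a^* * p + '[D x, x]).
  by rewrite (linearP D) /= hdotDl hdotZl !hdotDr !hdotZr.
have real z := ge0_conj (D0 z).
have C a : a * p^* + a^* * q^* = a^* * p + a * q.
  have := real (a *: y + x); rewrite E !(rmorphD, rmorphM) /= !conjCK !real.
  move=> /(congr1 (fun z => z - a * a^* * '[D y, y] - '[D x, x])) h.
  transitivity (a^* * (a * '[D y, y] + q^*) + (a * p^* + '[D x, x]) -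
    a * a^* * '[D y, y] - '[D x, x]); first by ring.
  by rewrite h; ring.
have := C 1; rewrite conjC1 !mul1r => C1.
have : p^* - q^* = - p + q.
  apply: (mulfI (neq0Ci R[i])); have := C 'i; rewrite conjCi => Ci.
  by rewrite mulrBr mulrDr mulrN -!mulNr.
move=> C2; have two0 : (2 : R[i]) != 0 by rewrite pnatr_eq0.
have pq : p^* = q.
  apply: (mulfI two0); transitivity ((p^* + q^*) + (p^* - q^*)); first by ring.
  by rewrite C1 C2; ring.
by rewrite [RHS]hdotC -/q -pq conjCK.
Qed.

(** The iteration Y := (B + Y^2) / 2.  A fixed point Y satisfies
    (1 - Y)^2 = 1 - B, so that 1 - Y is a square root of 1 - B. *)
Fixpoint sqrt_iter H (B : H -> H) k : H -> H :=
  if k is k'.+1 then fun x => 2^-1 *: (B x + sqrt_iter B k' (sqrt_iter B k' x))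
  else fun _ => 0.

(** The same iteration with the number 1 in place of B; its increments dominate
    those of the operator iteration whenever B is a contraction. *)
Fixpoint sqrt_scal k : R := if k is k'.+1 then (1 + sqrt_scal k' ^+ 2) / 2 else 0.

Lemma sqrt_scal_bounds k : 0 <= sqrt_scal k <= 1.
Proof.
elim: k => [|k /andP[h0 h1]] /=; first by rewrite lexx ler01.
have h2 : sqrt_scal k ^+ 2 <= 1 by rewrite exprn_ile1.
have h3 : 0 <= sqrt_scal k ^+ 2 by exact: sqr_ge0.
by apply/andP; split; lra.
Qed.

Lemma sqrt_scal_nd k : sqrt_scal k <= sqrt_scal k.+1.
Proof. by rewrite /= -subr_ge0; have := sqr_ge0 (1 - sqrt_scal k); nra. Qed.

Lemma sqrt_scal_mono : {homo sqrt_scal : k l / (k <= l)%N >-> k <= l}.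
Proof. by apply: homo_leq => //; [exact: le_trans|exact: sqrt_scal_nd]. Qed.

Lemma sqrt_scal_cvg : sqrt_scal @ \oo --> sup (range sqrt_scal).
Proof.
apply: nondecreasing_cvgn; first exact: sqrt_scal_mono.
by exists 1 => _ [k _ <-]; have /andP[] := sqrt_scal_bounds k.
Qed.

Lemma nr_half (V : normedModType R[i]) (x : V) : nr (2^-1 *: x) = nr x / 2.
Proof.
rewrite nrZ mulrC; congr (_ * _).
by rewrite normfV ger0_norm // (_ : 2^-1 = (2^-1 : R)%:C%C) // rmorphV ?unitfE //= rmorph_nat.
Qed.

Section Limit.
Variables (H : hilbertType R) (B : {bounded H -> H}).
Hypothesis B1 : forall x, nr (B x) <= nr x.
Local Notation Y := (sqrt_iter B).
Local Notation a := sqrt_scal.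

Lemma sqrt_iter_linear k : linear (Y k).
Proof.
elim: k => [|k IH] c x y /=; first by rewrite scaler0 addr0.
rewrite !IH linearP /= scalerA [c * _]mulrC -scalerA -scalerDr.
by congr (_ *: _); rewrite scalerDr addrACA.
Qed.

HB.instance Definition _ k := GRing.isLinear.Build R[i] H H _ (Y k) (sqrt_iter_linear k).

Lemma sqrt_iterB k x y : Y k (x - y) = Y k x - Y k y.
Proof. exact: (raddfB (Y k)). Qed.

Lemma sqrt_iter_nr k x : nr (Y k x) <= a k * nr x.
Proof.
elim: k x => [|k IH] x /=; first by rewrite nr0 mul0r.
rewrite nr_half ler_pdivrMr //; apply: le_trans (nrD _ _) _.
have := IH (Y k x); have := IH x; have := B1 x.
have /andP[a0 _] := sqrt_scal_bounds k => h1 h2 h3.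
have h4 : a k * nr (Y k x) <= a k * (a k * nr x) by rewrite ler_wpM2l.
by rewrite mulrAC divfK // mulrDl mul1r expr2 -mulrA; lra.
Qed.

(** Y_{k+1}^2 - Y_k^2 = Y_{k+1} (Y_{k+1} - Y_k) + (Y_{k+1} - Y_k) Y_k, and the
    scalar iterates satisfy the same identity. *)
Lemma sqrt_iter_step k x : nr (Y k.+1 x - Y k x) <= (a k.+1 - a k) * nr x.
Proof.
elim: k x => [|k IH] x; first by rewrite !subr0; exact: (sqrt_iter_nr 1).
have -> : Y k.+2 x - Y k.+1 x =
    2^-1 *: (Y k.+1 (Y k.+1 x - Y k x) + (Y k.+1 (Y k x) - Y k (Y k x))).
  transitivity (2^-1 *: (B x + Y k.+1 (Y k.+1 x)) - 2^-1 *: (B x + Y k (Y k x))) => //.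
  by rewrite -scalerBr opprD addrACA subrr add0r sqrt_iterB subrKA.
rewrite nr_half ler_pdivrMr //; apply: le_trans (nrD _ _) _.
have h1 := sqrt_iter_nr k.+1 (Y k.+1 x - Y k x).
have h2 := IH (Y k x); have h3 := IH x; have h4 := sqrt_iter_nr k x.
have /andP[a0 _] := sqrt_scal_bounds k; have /andP[b0 _] := sqrt_scal_bounds k.+1.
have d0 : 0 <= a k.+1 - a k by rewrite subr_ge0 sqrt_scal_nd.
have h5 := ler_wpM2l b0 h3; have h6 := ler_wpM2l d0 h4.
apply: le_trans (lerD (le_trans h1 h5) (le_trans h2 h6)) _.
by rewrite [a k.+2]/= -/(a k.+1) le_eqVlt; apply/orP; left; apply/eqP; rewrite /=; field.
Qed.

Lemma sqrt_iter_cauchy k l x : (k <= l)%N -> nr (Y l x - Y k x) <= (a l - a k) * nr x.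
Proof.
elim: l => [|l IH]; first by rewrite leqn0 => /eqP ->; rewrite !subrr nr0 mul0r.
rewrite leq_eqVlt => /predU1P[->|]; first by rewrite !subrr nr0 mul0r.
rewrite ltnS => /IH h; apply: le_trans (nr_triangle _ (Y l x) _) _.
have := sqrt_iter_step l x; have -> : a l.+1 - a k = a l.+1 - a l + (a l - a k) by ring.
by move=> h1; rewrite mulrDl; exact: lerD h1 h.
Qed.

Lemma sqrt_iter_is_cvg x : cvg (Y k x @[k --> \oo]).
Proof.
apply/cauchy_cvgP/cauchyP => e; rewrite ltcE /= => /andP[/eqP e0 e1].
(* The summand 1 covers the case x = 0. *)
have n0 : 0 < nr x + 1 by rewrite ltr_wpDl ?nr_ge0.
have /cvgrPdist_lt/(_ (complex.Re e / (nr x + 1))) := sqrt_scal_cvg.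
rewrite divr_gt0 // => /(_ isT)[N _ NP].
exists (Y N x); exists N => // k /= Nk; rewrite -ball_normE /ball_ /=.
rewrite -normrN opprB nrE ltcE /= -e0 eqxx /=.
apply: le_lt_trans (sqrt_iter_cauchy x Nk) _.
have sk : a k <= sup (range a).
  by apply: sup_upper_bound; [split; [exists (a 0), 0|exists 1 => _ [m _ <-];
     have /andP[] := sqrt_scal_bounds m]|exists k].
have aNk := sqrt_scal_mono Nk; have := NP N (leqnn N).
rewrite /= ger0_norm ?subr_ge0 ?(le_trans aNk) // ltr_pdivlMr // => lt1.
apply: le_lt_trans lt1; apply: ler_pM; rewrite ?subr_ge0 ?nr_ge0 //.
  by rewrite lerB.
by rewrite lerDl.
Qed.

Definition sqrt_lim x : H := lim (Y k x @[k --> \oo]).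

Lemma sqrt_lim_cvg x : Y k x @[k --> \oo] --> sqrt_lim x.
Proof. exact: sqrt_iter_is_cvg. Qed.

End Limit.
Arguments sqrt_lim_cvg [H B] B1 x.

Lemma lim_uniq (V : normedModType R[i]) (T : Type) (F : set_system T) {FF : ProperFilter F}
    (u : T -> V) (l l' : V) :
  u @ F --> l -> u @ F --> l' -> l = l'.
Proof. by move=> h h'; apply: (@cvg_unique V (@norm_hausdorff _ V) (u @ F)). Qed.

Lemma nr_cvg_le (V : normedModType R[i]) (u : nat -> V) (l : V) (c : R) :
  u @ \oo --> l -> (forall k, nr (u k) <= c) -> nr l <= c.
Proof.
move=> ul uc; apply/ler_addgt0Pr => e e0.
have /cvgrPdist_lt/(_ e%:C%C) := ul; rewrite ltcR => /(_ e0)[N _ /(_ N (leqnn N))].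
rewrite /= nrE ltcR => lt1.
have := nr_triangle l (u N) 0; rewrite !subr0 => h; apply: le_trans h _.
by rewrite addrC lerD // ltW.
Qed.

Lemma nr_cvgP (V : normedModType R[i]) (u : nat -> V) (l : V) :
  (forall e : R, 0 < e -> exists N, forall k, (N <= k)%N -> nr (l - u k) < e) ->
  u @ \oo --> l.
Proof.
move=> h; apply/cvgrPdist_lt => e; rewrite ltcE /= => /andP[/eqP e0 /h[N NP]].
by exists N => // k /NP; rewrite /= nrE => lt1; rewrite ltcE /= -e0 eqxx.
Qed.

Section LimitTheory.
Variables (H : hilbertType R) (B : {bounded H -> H}).
Hypothesis B1 : forall x, nr (B x) <= nr x.
Hypothesis Bsym : forall x y, '[B x, y] = '[x, B y].
Local Notation Y := (sqrt_iter B).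
Local Notation L := (sqrt_lim B).

Lemma sqrt_lim_linear : linear L.
Proof.
move=> c x y; apply: lim_uniq (sqrt_lim_cvg B1 _) _.
under eq_fun do rewrite (sqrt_iter_linear B).
by apply: cvgD (sqrt_lim_cvg B1 y); apply: cvgZl_tmp; exact: sqrt_lim_cvg.
Qed.

Lemma sqrt_lim_nr x : nr (L x) <= 1 * nr x.
Proof.
apply: nr_cvg_le (sqrt_lim_cvg B1 x) _ => k; apply: le_trans (sqrt_iter_nr B1 _ _) _.
by rewrite ler_wpM2r ?nr_ge0 //; have /andP[] := sqrt_scal_bounds k.
Qed.

Definition sqrt_limb : {bounded H -> H} := bounded_of sqrt_lim_linear sqrt_lim_nr.

Lemma sqrt_limB x y : L (x - y) = L x - L y.
Proof. exact: (raddfB sqrt_limb). Qed.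

Lemma sqrt_iter_sym k x y : '[Y k x, y] = '[x, Y k y].
Proof.
elim: k x y => [|k IH] x y /=; first by rewrite hdot0l hdot0r.
by rewrite hdotZl hdotZr hdotDl hdotDr Bsym !IH fmorphV rmorph_nat.
Qed.

Lemma sqrt_lim_sym x y : '[L x, y] = '[x, L y].
Proof.
apply: (@lim_uniq R[i] _ _ _ _ _ _ (hdot_cvg y (sqrt_lim_cvg B1 x))).
rewrite (hdotC x) (_ : (fun k => _) = fun k => '[Y k y, x]^*).
  by apply: cvg_conjC; exact: (hdot_cvg x (sqrt_lim_cvg B1 y)).
by apply/funext => k; rewrite sqrt_iter_sym -hdotC.
Qed.

Lemma sqrt_lim_eq x : L x = 2^-1 *: (B x + L (L x)).
Proof.
have h : (fun k => Y k.+1 x) @ \oo --> L x.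
  by rewrite (cvg_shiftS (fun k => Y k x)); exact: sqrt_lim_cvg.
apply: (lim_uniq h) => /=.
apply: cvgZl_tmp; apply: cvgD; first exact: cvg_cst.
rewrite (_ : (fun k => _) = fun k => Y k (Y k x - L x) + Y k (L x)).
  rewrite -[L (L x)]add0r; apply: cvgD (sqrt_lim_cvg B1 _).
  apply: nr_cvgP => e e0.
  have /cvgrPdist_lt/(_ e%:C%C) := sqrt_lim_cvg B1 x; rewrite ltcR => /(_ e0)[N _ NP].
  exists N => k /NP; rewrite /= nrE ltcR sub0r nrN nrB; apply: le_lt_trans.
  apply: le_trans (sqrt_iter_nr B1 _ _) _.
  by rewrite ler_piMl ?nr_ge0 //; have /andP[] := sqrt_scal_bounds k.
by apply/funext => k; rewrite sqrt_iterB subrK.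
Qed.

End LimitTheory.

(** The iterates are polynomials in B and in C with the same coefficients. *)
Lemma sqrt_iter_intertwine H K (B : {bounded H -> H}) (C : {bounded K -> K})
    (T : {bounded H -> K}) :
  (forall x, T (B x) = C (T x)) ->
  forall k x, T (sqrt_iter B k x) = sqrt_iter C k (T x).
Proof.
move=> TB; elim=> [|k IH] x /=; first exact: linear0.
by rewrite linearZ_LR linearD /= TB !IH.
Qed.

Lemma sqrt_lim_intertwine H K (B : {bounded H -> H}) (C : {bounded K -> K})
    (T : {bounded H -> K}) :
  (forall x, nr (B x) <= nr x) -> (forall x, nr (C x) <= nr x) ->
  (forall x, T (B x) = C (T x)) ->
  forall x, T (sqrt_lim B x) = sqrt_lim C (T x).
Proof.
move=> B1 C1 TB x.
apply: lim_uniq (bounded_cvg T (sqrt_lim_cvg B1 x)) _.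
under eq_fun do rewrite (sqrt_iter_intertwine TB).
exact: sqrt_lim_cvg.
Qed.

Section SqrtOneMinus.
Variables (H : hilbertType R) (B : {bounded H -> H}).
Hypothesis B1 : forall x, nr (B x) <= nr x.
Hypothesis Bsym : forall x y, '[B x, y] = '[x, B y].

Definition sqrt1B : {bounded H -> H} := idfun \- sqrt_limb B1.

Lemma sqrt1B_sqr x : sqrt1B (sqrt1B x) = x - B x.
Proof.
rewrite /sqrt1B /= (sqrt_limB B1).
have := sqrt_lim_eq B1 x => /(congr1 (fun z => 2 *: z)).
rewrite scalerA divff ?pnatr_eq0 // scale1r scaler_nat mulr2n => e.
have -> : B x = sqrt_lim B x + sqrt_lim B x - sqrt_lim B (sqrt_lim B x) by rewrite e addrK.
by rewrite -[in LHS]addrA -[in LHS]opprD addrA.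
Qed.

Lemma sqrt1B_ge0 : op_ge0 sqrt1B.
Proof.
move=> x; rewrite /sqrt1B /= hdotBl; apply: ge0C.
  by rewrite rmorphB /= -!hdotC sqrt_lim_sym.
rewrite raddfB /= hdot_nr /= subr_ge0.
apply: (@le_trans _ _ (nr (sqrt_lim B x) * nr x)).
  by apply: le_trans (nr_CS _ _); apply: le_trans (ler_norm _) (normC_ge_Re _).
by rewrite expr2 ler_wpM2r ?nr_ge0 // -[leRHS]mul1r sqrt_lim_nr.
Qed.

Lemma sqrt1B_is_sqrt : is_sqrt (fun x => x - B x) sqrt1B.
Proof. by split; [exact: sqrt1B_ge0|exact: sqrt1B_sqr]. Qed.

(** If u = D y were nonzero, then D would take a negative value at y - t u for
    small t > 0, of which t = 1 / M is small enough. *)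
Lemma op_ge0_dot0 (D : {bounded H -> H}) y : op_ge0 D -> '[D y, y] = 0 -> D y = 0.
Proof.
move=> D0 Dy; have [M M0 DM] := boundedP D.
have Dsym := op_ge0_sym D0.
pose u := D y; pose t : R := M^-1; pose n2 := nr u ^+ 2.
have tC : (t%:C%C)^* = t%:C%C by apply/CrealP; rewrite complex_real.
have yu : '[D y, u] = n2%:C%C by rewrite hdot_nr.
have uy : '[D u, y] = n2%:C%C by rewrite Dsym hdot_nr.
have := D0 (y - t%:C%C *: u).
have -> : '[D (y - t%:C%C *: u), y - t%:C%C *: u] =
    (t ^+ 2)%:C%C * '[D u, u] - (2 * t * n2)%:C%C.
  rewrite (raddfB D) /= (linearZ_LR D) /= hdotBl !hdotBr !hdotZl !hdotZr Dy yu uy tC.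
  by rewrite !(rmorphM, rmorphXn) /= rmorph_nat; ring.
rewrite lecE => /andP[_] /=.
have : complex.Re '[D u, u] <= M * n2.
  apply: (@le_trans _ _ (nr (D u) * nr u)).
    by apply: le_trans (nr_CS _ _); apply: le_trans (ler_norm _) (normC_ge_Re _).
  by rewrite /n2 expr2 mulrA ler_wpM2r ?nr_ge0.
case: ('[D u, u]) => d1 d2 /= d1M; rewrite mul0r subr0 => h.
have t0 : 0 < t by rewrite invr_gt0.
have : t ^+ 2 * d1 <= t * n2.
  by rewrite expr2 -mulrA ler_wpM2l ?(ltW t0) // /t mulrC ler_pdivrMr // mulrC.
move=> h2; have : t * n2 <= 0 by lra.
rewrite pmulr_rle0 // => n20; apply: nr_eq0; rewrite -/u -(ler_pXn2r (n := 2)) ?nnegrE ?nr_ge0 //.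
by rewrite expr0n.
Qed.

(** Two positive square roots E and D of the same operator commute with each
    other, so (E + D) (E - D) = 0; by positivity both E and D vanish on the
    range of E - D, and hence E - D is zero. *)
Lemma sqrt1B_uniq (D : {bounded H -> H}) :
  is_sqrt (fun x => x - B x) D -> D =1 sqrt1B.
Proof.
move=> [D0 DD] x.
have Dsym := op_ge0_sym D0; have Epos := sqrt1B_ge0; have Esym := op_ge0_sym Epos.
have BE z : B z = z - D (D z) by rewrite DD opprB addrC subrK.
have DB z : D (B z) = B (D z) by rewrite !BE raddfB.
have DE z : D (sqrt1B z) = sqrt1B (D z).
  by rewrite /sqrt1B /= raddfB /= (sqrt_lim_intertwine B1 B1 DB).
have EB u v : sqrt1B (u - v) = sqrt1B u - sqrt1B v := raddfB sqrt1B u v.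
have DBm u v : D (u - v) = D u - D v := raddfB D u v.
have EE := sqrt1B_sqr; set E := sqrt1B in Epos Esym DE EB EE *; clearbody E.
pose y := D x - E x.
have ED : E y + D y = 0.
  by rewrite /y EB DBm DE EE DD addrC addrA subrK subrr.
have Ey : '[E y, y] = 0.
  have : '[E y, y] + '[D y, y] = 0 by rewrite -hdotDl ED hdot0l.
  move=> /eqP; rewrite paddr_eq0; [|exact: Epos|exact: D0].
  by move=> /andP[/eqP].
have Ey0 := op_ge0_dot0 Epos Ey.
have Dy0 : D y = 0 by move: ED; rewrite Ey0 add0r.
apply/subr0_eq/hdot_eq0.
by rewrite -/y {1}/y hdotBl Dsym Esym Dy0 Ey0 !hdot0r subrr.
Qed.

Lemma op_sqrt1BE : op_sqrt (fun x => x - B x) =1 sqrt1B.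
Proof.
apply: sqrt1B_uniq; rewrite /op_sqrt; case: pselect => [h|[]].
  exact: (projT2 (cid h)).
by exists sqrt1B; exact: sqrt1B_is_sqrt.
Qed.

End SqrtOneMinus.

Section Defects.
Variables (H K : hilbertType R) (f : {bounded H -> K}).
Hypothesis f1 : forall x, nr (f x) <= nr x.

Lemma adj_contr y : nr (adj f y) <= nr y.
Proof. by rewrite -[leRHS]mul1r; apply: adj_nr => // x; rewrite mul1r. Qed.

Lemma adjf_contr x : nr ((adj f \o f) x) <= nr x.
Proof. exact: le_trans (adj_contr _) (f1 _). Qed.

Lemma adjf_sym x y : '[(adj f \o f) x, y] = '[x, (adj f \o f) y].
Proof. by rewrite /= -adjPr adjP. Qed.

Lemma op_sqrt_is_sqrt :
  is_sqrt (fun x => x - adj f (f x)) (op_sqrt (fun x => x - adj f (f x))).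
Proof.
have E := op_sqrt1BE adjf_contr adjf_sym; have [S0 SS] := sqrt1B_is_sqrt adjf_contr adjf_sym.
by split=> [x|x]; rewrite !E; [exact: S0|exact: SS].
Qed.

Lemma op_sqrt_sym x y :
  '[op_sqrt (fun x => x - adj f (f x)) x, y] = '[x, op_sqrt (fun x => x - adj f (f x)) y].
Proof. exact: (op_ge0_sym op_sqrt_is_sqrt.1). Qed.

Lemma op_sqrt_dot x y :
  '[op_sqrt (fun x => x - adj f (f x)) x, op_sqrt (fun x => x - adj f (f x)) y] =
  '[x, y] - '[f x, f y].
Proof. by rewrite op_sqrt_sym op_sqrt_is_sqrt.2 hdotBr -adjP. Qed.

End Defects.

(** The square root of 1 - f^* f is a limit of polynomials in f^* f, and f
    intertwines each polynomial in f^* f with the same one in f f^*. *)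
Lemma op_sqrt_intertwine H K (f : {bounded H -> K}) :
  (forall x, nr (f x) <= nr x) -> forall x,
  f (op_sqrt (fun x => x - adj f (f x)) x) =
  op_sqrt (fun y => y - adj (adj f) (adj f y)) (f x).
Proof.
move=> f1 x; have g1 := adj_contr f1.
rewrite (op_sqrt1BE (adjf_contr f1) (adjf_sym f)).
rewrite (op_sqrt1BE (adjf_contr g1) (adjf_sym (adj f))).
rewrite /sqrt1B /= raddfB /=; congr (_ - _).
apply: (sqrt_lim_intertwine (adjf_contr f1) (adjf_contr g1)) => z /=.
by rewrite adjK.
Qed.

End SquareRoot.

(** * Row and column operators of a family *)

Section L2Theory.
Variables (R : realType) (I : choiceType).
Implicit Types (E : hilbertType R).

Lemma l2_dotE E (x y : l2 I E) : '[x, y] = summability.sum (fun i => '[x i, y i]).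
Proof. by []. Qed.

Lemma l2_dot_ext E E' (x y : l2 I E) (x' y' : l2 I E') :
  (forall i, '[x i, y i] = '[x' i, y' i]) -> '[x, y] = '[x', y'].
Proof. by move=> h; rewrite !l2_dotE; congr summability.sum; apply/funext. Qed.

Lemma l2_dot0 E (x y : l2 I E) : (forall i, '[x i, y i] = 0) -> '[x, y] = 0.
Proof.
by move=> h; rewrite (@l2_dot_ext _ _ x y (0 : l2 I E) 0) ?hdot0l // => i; rewrite h hdot0l.
Qed.

Lemma dot_tens E (x : l2 I E) i (e : E) : '[x, tens (l2_basis i) e] = '[x i, e].
Proof.
apply: l2_dot_eq; apply: (cvg_near_cst (U := R[i])).
exists [fset i]%fset => // A; rewrite /= fsub1set => iA; apply/eqP.
rewrite partial_sumE (big_fsetD1 i) //= eqxx scale1r big_seq big1 ?addr0 // => j.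
by rewrite !inE => /andP[/negPf ji _]; rewrite ji scale0r hdot0r.
Qed.

Lemma tens_linear E (f : l2 I R[i]) : linear (@tens R I E f).
Proof.
by move=> a x y; apply: l2P => i; rewrite l2DE l2ZE /= scalerDr !scalerA mulrC.
Qed.

Lemma nr_tens_basis E i (e : E) : nr (tens (l2_basis i) e : l2 I E) = nr e.
Proof.
have : nr (tens (l2_basis i) e : l2 I E) ^+ 2 = nr e ^+ 2.
  have := hdot_nr (tens (l2_basis i) e : l2 I E).
  by rewrite dot_tens tens_basisE eqxx hdot_nr => /(congr1 (@complex.Re R)) /= <-.
by move=> /eqP; rewrite eqrXn2 ?nr_ge0 // => /eqP.
Qed.

Lemma tens_basis_nr E i (e : E) : nr (tens (l2_basis i) e : l2 I E) <= 1 * nr e.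
Proof. by rewrite mul1r nr_tens_basis. Qed.

Definition tensb E i : {bounded E -> l2 I E} :=
  bounded_of (@tens_linear E (l2_basis i)) (@tens_basis_nr E i).

Lemma l2_nr_le E (x : l2 I E) (c : R) :
  (forall A : {fset I}, \sum_(i <- A) `|x i| ^+ 2 <= (c ^+ 2)%:C%C) ->
  0 <= c -> nr x <= c.
Proof.
move=> h c0; rewrite -(ler_pXn2r (n := 2)) ?nnegrE ?nr_ge0 //.
by rewrite -lecR -hdot_nr; exact: (l2_dot_le h).
Qed.

Lemma nr_sqr_normE (V : normedModType R[i]) (x : V) : `|x| ^+ 2 = (nr x ^+ 2)%:C%C.
Proof. by rewrite nrE -rmorphXn. Qed.

(** Elementary tensors of basis vectors have dense span. *)
Lemma l2_bounded_ext E (K : hilbertType R) (f g : {bounded l2 I E -> K}) :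
  (forall i e, f (tens (l2_basis i) e) = g (tens (l2_basis i) e)) -> f =1 g.
Proof.
move=> fg x; have xc := @tens_basis_cvg _ _ _ x.
pose p A := partial_sum (fun i => tens (l2_basis i) (x i)) A.
have gl : (fun A => g (p A)) @ totally --> g x by exact: (bounded_cvg g xc).
have fl : (fun A => f (p A)) @ totally --> f x by exact: (bounded_cvg f xc).
apply: (lim_uniq fl); rewrite (_ : (fun A => f (p A)) = fun A => g (p A)) //.
by apply/funext => A; rewrite /p !partial_sumE !raddf_sum; apply: eq_bigr => i _; exact: fg.
Qed.

End L2Theory.

Section Row.
Variables (R : realType) (I : choiceType) (E K : hilbertType R).
Implicit Types (T : I -> {bounded E -> K}).

Definition row_contr T := forall h (A : {fset I}),
  \sum_(i <- A) `|adj (T i) h| ^+ 2 <= `|h| ^+ 2.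

Variable T : I -> {bounded E -> K}.
Hypothesis hT : row_contr T.

Lemma col_in h : (fun i => adj (T i) h) \in @sq_summable R I E.
Proof. by apply/asboolP; exists (`|h| ^+ 2) => A; exact: hT. Qed.

Definition col_fun h : l2 I E := L2 (col_in h).

Lemma col_linear : linear col_fun.
Proof. by move=> a x y; apply: l2P => i; rewrite l2DE l2ZE /= linearP. Qed.

Lemma col_nr h : nr (col_fun h) <= 1 * nr h.
Proof.
rewrite mul1r; apply: l2_nr_le; last exact: nr_ge0.
by move=> A; rewrite -nr_sqr_normE; exact: hT.
Qed.

Definition col : {bounded K -> l2 I E} := bounded_of col_linear col_nr.

Definition row : {bounded l2 I E -> K} := adj col.

Lemma colE h i : col h i = adj (T i) h. Proof. by []. Qed.

Lemma col_contr h : nr (col h) <= nr h.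
Proof. by rewrite -[leRHS]mul1r; exact: col_nr. Qed.

Lemma row_contr_nr x : nr (row x) <= nr x.
Proof. exact: (adj_contr col_contr). Qed.

Lemma row_tens i e : row (tens (l2_basis i) e) = T i e.
Proof. by apply: adj_uniq => h; rewrite dot_tens colE -adjPr hdotC -hdotC. Qed.

Lemma row_cvg (x : l2 I E) : partial_sum (fun i => T i (x i)) @ totally --> row x.
Proof.
pose p A := partial_sum (fun i => tens (l2_basis i) (x i)) A.
have : (fun A => row (p A)) @ totally --> row x.
  exact: (bounded_cvg row (@tens_basis_cvg _ _ _ x)).
rewrite (_ : (fun A => row (p A)) = partial_sum (fun i => T i (x i))) //.
rewrite /p; apply/funext => A; rewrite !partial_sumE raddf_sum /=; apply: eq_bigr => i _.
exact: row_tens.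
Qed.

Lemma sum_rowE (x : l2 I E) : summability.sum (fun i => T i (x i)) = row x.
Proof. by have /cvg_lim := @row_cvg x; apply; exact: norm_hausdorff. Qed.

Lemma row_dot x h : '[row x, h] = '[x, col h].
Proof. by rewrite hdotC -adjP -hdotC. Qed.

(** The sum is orthogonal to every z orthogonal to M, since each term is. *)
Lemma row_subspace (M : subspace K) (x : l2 I E) :
  (forall i, (M : set K) (T i (x i))) -> (M : set K) (row x).
Proof.
move=> h; apply: bipolar => z Mz; rewrite row_dot; apply: l2_dot0 => i.
by rewrite colE -adjP; exact: Mz.
Qed.

End Row.

Section Isometries.
Variables (R : realType).

(** The form of V^* V - 1 vanishes on the diagonal; it is thus positive, and a
    positive operator kills its isotropic vectors. *)
Lemma isometry_dot (E K : hilbertType R) (V : {bounded E -> K}) :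
  isometry_op V -> forall x y, '[V x, V y] = '[x, y].
Proof.
move=> Vi; pose D : {bounded E -> E} := (adj V \o V) \- idfun.
have D0 x : '[D x, x] = 0.
  by rewrite /D /= hdotBl -adjPr !hdot_norm Vi subrr.
have Dx x : D x = 0 by apply: op_ge0_dot0 => // z; rewrite D0.
by move=> x y; rewrite adjPr; congr ('[_, _]); apply/subr0_eq/Dx.
Qed.

Variables (I : choiceType) (E K : hilbertType R).

Definition orth_isometries (V : I -> {bounded E -> K}) :=
  forall i j x y, '[V i x, V j y] = if i == j then '[x, y] else 0.

Lemma orth_isometriesP (V : I -> {bounded E -> K}) :
  (forall i, isometry_op (V i)) ->
  (forall i j, i != j -> forall x y, '[V i x, V j y] = 0) -> orth_isometries V.
Proof.
move=> Vi Vo i j x y; case: eqVneq => [<-|]; first exact: isometry_dot.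
by move=> ij; exact: Vo.
Qed.

Variable V : I -> {bounded E -> K}.
Hypothesis oV : orth_isometries V.

Lemma orth_adj i j x : adj (V i) (V j x) = if i == j then x else 0.
Proof.
apply: adj_uniq => y; rewrite oV eq_sym; case: ifP => _ //.
by rewrite hdot0r.
Qed.

(** This is the Bessel inequality: the partial sums y of the V_i V_i^* h satisfy
    (y, y) = (h, y). *)
Lemma orth_row_contr : row_contr V.
Proof.
move=> h A; pose s := \sum_(i <- A) `|adj (V i) h| ^+ 2.
pose y := \sum_(i <- A) V i (adj (V i) h).
have dy x : '[y, x] = \sum_(i <- A) '[adj (V i) h, adj (V i) x].
  by rewrite /y hdot_suml; apply: eq_bigr => i _; rewrite adjP.
have yh : '[y, h] = s by rewrite dy; apply: eq_bigr => i _; exact: hdot_norm.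
have ay i : i \in A -> adj (V i) y = adj (V i) h.
  move=> iA; rewrite /y raddf_sum /= (big_fsetD1 i) //= orth_adj eqxx big_seq big1 ?addr0 // => j.
  by rewrite !inE => /andP[/negPf ji _]; rewrite orth_adj eq_sym ji.
have yy : '[y, y] = s.
  by rewrite dy big_seq [RHS]big_seq; apply: eq_bigr => i /ay ->; exact: hdot_norm.
have s_real : s^* = s by rewrite -yy -hdotC.
have := dot_ge0 (@hdot R K) (h - y).
rewrite -/(hdot _ _) hdotBl !hdotBr yy yh [ '[h, y]]hdotC yh s_real subrr subr0 subr_ge0.
by rewrite hdot_norm.
Qed.

Lemma orth_col_row y : col orth_row_contr (row orth_row_contr y) = y.
Proof.
apply: l2P => i; rewrite colE; apply: hdot_inj => z.
rewrite -adjPr row_dot -dot_tens; apply: l2_dot_ext => j.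
by rewrite colE orth_adj tens_basisE.
Qed.

Lemma orth_row_dot x y : '[row orth_row_contr x, row orth_row_contr y] = '[x, y].
Proof. by rewrite row_dot orth_col_row. Qed.

End Isometries.

Section Contr.
Variables (R : realType) (n : option nat) (H : hilbertType R).

Lemma partial_sum_le (I : choiceType) (c : I -> R[i]) (l : R[i]) :
  (forall i, 0 <= c i) -> partial_sum c @ totally --> l ->
  forall A : {fset I}, \sum_(i <- A) c i <= l.
Proof.
move=> c0 cl A; apply: (@closed_cvg _ _ _ _ _ _ (ge0_closed (c := _))) cl.
exists A => // B /= AB; rewrite partial_sumE (sum_fsetD _ AB).
by rewrite lerDl sumr_ge0.
Qed.

Lemma TTstar_row_contr (T : optuple n H) :
  op_summable (TTstar T) -> (forall h, '[op_sum (TTstar T) h, h] <= '[h, h]) ->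
  row_contr T.
Proof.
move=> Ts Tl h A; rewrite -hdot_norm; apply: le_trans (Tl h).
have : partial_sum (fun i => `|adj (T i) h| ^+ 2) @ totally --> '[op_sum (TTstar T) h, h].
  pose p A := partial_sum (fun i => TTstar T i h) A.
  have : (fun A => '[p A, h]) @ totally --> '[op_sum (TTstar T) h, h].
    exact: (hdot_cvg h (Ts h)).
  rewrite (_ : (fun A => '[p A, h]) = partial_sum (fun i => `|adj (T i) h| ^+ 2)) //.
  rewrite /p; apply/funext => B; rewrite !partial_sumE hdot_suml; apply: eq_bigr => i _ /=.
  by rewrite -hdot_norm /TTstar /= adjP.
by move=> h1; apply: (partial_sum_le _ h1) => i; rewrite exprn_ge0.
Qed.

Lemma row_contraction_contr (T : optuple n H) : row_contraction T -> row_contr T.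
Proof.
move=> [Ts Tl]; apply: TTstar_row_contr => // h.
by have := Tl h; rewrite hdotBl subr_ge0.
Qed.

Lemma TTstarE (T : optuple n H) (hT : row_contr T) :
  op_sum (TTstar T) =1 row hT \o col hT.
Proof. by move=> h; rewrite /= -sum_rowE. Qed.

Lemma row_contr_contraction (T : optuple n H) : row_contr T -> row_contraction T.
Proof.
move=> hT; split=> h.
  by apply/cvg_ex; exists (row hT (col hT h)); have h1 := @row_cvg _ _ _ _ T hT (col hT h).
rewrite hdotBl TTstarE /= row_dot subr_ge0 !hdot_nr lecR ler_pXn2r ?nnegrE ?nr_ge0 //.
exact: col_contr.
Qed.

Lemma cuntz_row_contr (A : optuple n H) : cuntz_row_isometry A -> row_contr A.
Proof. by move=> [_ As Ae]; apply: TTstar_row_contr => // h; rewrite Ae. Qed.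

Lemma cuntz_row_col (A : optuple n H) (cA : cuntz_row_isometry A) h :
  row (cuntz_row_contr cA) (col (cuntz_row_contr cA) h) = h.
Proof. by have [_ _ Ae] := cA; have := Ae h; rewrite (TTstarE (cuntz_row_contr cA)). Qed.

End Contr.

(** * The Cuntz part of an isometric dilation *)

Section CuntzSpace.
Variables (R : realType) (n : option nat) (K : hilbertType R).
Variable V : optuple n K.
Hypothesis oV : orth_isometries V.

Definition level k : subspace K :=
  clspan (\bigcup_(w in [set w : seq (gen n) | size w = k]) range (opword V w)).

Lemma opword_cat (v w : seq (gen n)) x : opword V (v ++ w) x = opword V v (opword V w x).
Proof. by elim: v => //= i v ->. Qed.

Lemma level_word w x : (level (size w) : set K) (opword V w x).
Proof. by apply: clspan_in; exists w. Qed.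

Lemma level_ind k (M : subspace K) :
  (forall w x, size w = k -> (M : set K) (opword V w x)) ->
  (level k : set K) `<=` (M : set K).
Proof. by move=> h; apply: clspan_min => _ [w wk [x _ <-]]; exact: h. Qed.

Lemma level0 x : (level 0 : set K) x.
Proof. exact: (@level_word [::] x). Qed.

Lemma level_shift k i x : (level k : set K) x -> (level k.+1 : set K) (V i x).
Proof.
apply: (@level_ind k (preim_subspace (V i) (level k.+1))) => w y <-.
exact: (@level_word (i :: w) y).
Qed.

Lemma level_unshift k i x : (level k.+1 : set K) x -> (level k : set K) (adj (V i) x).
Proof.
apply: (@level_ind k.+1 (preim_subspace (adj (V i)) (level k))) => -[//|j w] y [<-] /=.
rewrite orth_adj //; case: ifP => _; first exact: level_word.
exact: (@subspace0 _ _ (level (size w))).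
Qed.

Lemma level_decr k l x : (k <= l)%N -> (level l : set K) x -> (level k : set K) x.
Proof.
move=> kl; apply: (@level_ind l (level k)) => w y wl.
rewrite -(cat_take_drop k w) opword_cat -{1}(_ : size (take k w) = k).
  exact: level_word.
by rewrite size_takel ?wl.
Qed.

Lemma cuntz_spaceP x : (cuntz_space V : set K) x <-> forall k, (level k : set K) x.
Proof. by split=> [h k|h k _]; [exact: (h k I)|exact: h]. Qed.

Lemma cuntz_shift i x : (cuntz_space V : set K) x -> (cuntz_space V : set K) (V i x).
Proof.
by move=> /cuntz_spaceP h; apply/cuntz_spaceP => -[|k]; [exact: level0|exact: level_shift].
Qed.

Lemma cuntz_unshift i x :
  (cuntz_space V : set K) x -> (cuntz_space V : set K) (adj (V i) x).
Proof. by move=> /cuntz_spaceP h; apply/cuntz_spaceP => k; exact: level_unshift. Qed.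

(** A vector of the Cuntz space lies in the closed span of the ranges V_i K. *)
Lemma cuntz_ker x :
  (cuntz_space V : set K) x -> (forall i, adj (V i) x = 0) -> x = 0.
Proof.
move=> /cuntz_spaceP/(_ 1%N) h Vx; apply: hdot_eq0.
apply: clspan_ortho h => _ [[//|i w] _ [y _ <-]].
by rewrite /= adjP Vx hdot0r.
Qed.

Definition cuntz_part_fun i (x : sub_of (cuntz_space V)) : sub_of (cuntz_space V) :=
  SubOf (mem_set (cuntz_shift i (set_mem (valP x)))).

Lemma cuntz_part_linear i : linear (cuntz_part_fun i).
Proof. by move=> a x y; apply: val_inj => /=; rewrite linearP. Qed.

Lemma cuntz_part_nr i x : nr (cuntz_part_fun i x) <= 1 * nr x.
Proof.
have : nr (V i (val x)) ^+ 2 = nr (val x) ^+ 2.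
  by have := oV i i (val x) (val x); rewrite eqxx !hdot_nr => -[].
move=> /eqP; rewrite eqrXn2 ?nr_ge0 // => /eqP h.
by rewrite mul1r -[leRHS]/(nr (val x)) -h.
Qed.

Definition cuntz_part i : {bounded sub_of (cuntz_space V) -> sub_of (cuntz_space V)} :=
  bounded_of (@cuntz_part_linear i) (@cuntz_part_nr i).

Lemma cuntz_part_adj i x : sub_val (adj (cuntz_part i) x) = adj (V i) (sub_val x).
Proof.
have h := cuntz_unshift i (set_mem (valP x)).
suff -> : adj (cuntz_part i) x = SubOf (mem_set h) by [].
by apply: adj_uniq => y; exact: (adjP (V i) (sub_val y) (sub_val x)).
Qed.

Lemma cuntz_part_ker x : (forall i, adj (cuntz_part i) x = 0) -> x = 0.
Proof.
move=> h; apply: val_inj; have x0 := cuntz_ker (set_mem (valP x)).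
by apply: x0 => i; rewrite -cuntz_part_adj h.
Qed.

(** The levels decrease to the Cuntz space, so a vector orthogonal to the
    complement of every level lies in each level and hence in the Cuntz
    space. *)
Lemma cuntz_ortho_approx y :
  (forall x, (cuntz_space V : set K) x -> '[x, y] = 0) ->
  forall e : R, 0 < e -> exists k, exists2 u,
    forall m, (level k : set K) m -> '[m, u] = 0 & nr (y - u) < e.
Proof.
move=> yR e e0; pose U := [set u | exists k, forall m, (level k : set K) m -> '[m, u] = 0].
have U0 : U 0 by exists 0%N => m _; rewrite hdot0r.
have UD a u v : U u -> U v -> U (a *: u + v).
  move=> [k ku] [l lv]; exists (maxn k l) => m mm.
  rewrite hdotDr hdotZr ku ?lv ?mulr0 ?addr0 //.
    by apply: level_decr mm; exact: leq_maxr.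
  by apply: level_decr mm; exact: leq_maxl.
pose N := Subspace (@closed_closure _ U) (closure_submod (subspace_of_submod U0 UD)).
have : (N : set K) y.
  apply: bipolar => z zN; rewrite hdotC yR ?conjC0 //; apply/cuntz_spaceP => k.
  apply: bipolar => u uk; rewrite hdotC zN ?conjC0 //.
  by apply: subset_closure; exists k.
move=> /closure_normP/(_ e%:C%C); rewrite ltcR => /(_ e0)[u [k ku] yu].
by exists k, u => //; move: yu; rewrite nrE ltcR.
Qed.

End CuntzSpace.

Section CuntzIsometries.
Variables (R : realType) (n : option nat) (W : hilbertType R) (A : optuple n W).

(** The sum over i of |A_i^* A_j y|^2 is |A_j y|^2 = |y|^2, and the term i = j
    already has this value. *)
Lemma cuntz_orth : cuntz_row_isometry A -> orth_isometries A.
Proof.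
move=> cA; have [Ai _ _] := cA.
apply: orth_isometriesP => // i j ij x y; rewrite adjP.
suff -> : adj (A i) (A j y) = 0 by rewrite hdot0r.
have Aj : adj (A j) (A j y) = y.
  by apply: hdot_inj => z; rewrite -adjPr isometry_dot.
have := cuntz_row_contr cA (A j y) [fset i; j]%fset.
rewrite big_fsetU1 ?inE //= big_seq_fset1 Aj (Ai j) !nr_sqr_normE -rmorphD lecR gerDr => h.
apply: nr_eq0; rewrite -(ler_pXn2r (n := 2)) ?nnegrE ?nr_ge0 //.
by rewrite expr0n.
Qed.

End CuntzIsometries.

Section Similarity.
Variables (R : realType) (n : option nat) (H W K : hilbertType R).
Variables (T : optuple n H) (A : optuple n W) (S : {bounded H -> W}) (S' : {bounded W -> H}).
Hypothesis cA : cuntz_row_isometry A.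
Hypothesis SK : cancel S S'.
Hypothesis SK' : cancel S' S.
Hypothesis ST : forall i x, S (T i x) = A i (S x).
Variables (J : {bounded H -> K}) (V : optuple n K).
Hypothesis iJ : isometry_op J.
Hypothesis oV : orth_isometries V.
Hypothesis VJ : forall i h, adj (V i) (J h) = J (adj (T i) h).
Hypothesis cyc : forall r, (forall w h, '[opword V w (J h), r] = 0) -> r = 0.

(** Explicitly, m is the sum of V_v J S' A_v^* w over the words v of length k.  It
    compresses to S' w because T_v S' = S' A_v and the A_v A_v^* sum up to 1; its
    norm is controlled because the V_v have orthogonal ranges.  The recursion on
    k replaces sums over words by row operators. *)
Lemma level_preimage (C : R) : 0 < C -> (forall w, nr (S' w) <= C * nr w) ->
  forall k w, exists m, [/\ (level V k : set K) m, nr m <= C * nr w &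
    forall h, '[m, J h] = '[S' w, h]].
Proof.
move=> C0 S'C; elim=> [|k IH] w.
  exists (J (S' w)); split; [exact: level0| |by move=> h; rewrite isometry_dot].
  by rewrite /nr iJ; exact: S'C.
have /choice[m mP] : forall i, exists m, [/\ (level V k : set K) m,
    nr m <= C * nr (adj (A i) w) & forall h, '[m, J h] = '[S' (adj (A i) w), h]].
  by move=> i; exact: IH.
pose hA := cuntz_row_contr cA.
have sum_m (F : {fset gen n}) : \sum_(i <- F) `|m i| ^+ 2 <= ((C * nr w) ^+ 2)%:C%C.
  apply: (@le_trans _ _ (\sum_(i <- F) (C ^+ 2)%:C%C * `|adj (A i) w| ^+ 2)).
    apply: ler_sum => i _; rewrite !nr_sqr_normE -rmorphM lecR -exprMn.
    by have [_ mi _] := mP i; rewrite ler_pXn2r ?nnegrE ?mulr_ge0 ?nr_ge0 ?(ltW C0).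
  have -> : ((C * nr w) ^+ 2)%:C%C = (C ^+ 2)%:C%C * `|w| ^+ 2.
    by rewrite nr_sqr_normE -rmorphM exprMn.
  by rewrite -mulr_sumr; apply: ler_wpM2l (hA _ _); rewrite lecR exprn_ge0 ?(ltW C0).
have m_in : m \in @sq_summable R (gen n) K by apply/asboolP; exists ((C * nr w) ^+ 2)%:C%C.
pose y : l2 (gen n) K := L2 m_in.
exists (row (orth_row_contr oV) y); split.
- by apply: row_subspace => i; apply: level_shift; have [] := mP i.
- apply: le_trans (row_contr_nr _ _) _; apply: l2_nr_le => //.
  by rewrite mulr_ge0 ?nr_ge0 ?ltW.
- move=> h; rewrite row_dot.
  have -> : '[y, col (orth_row_contr oV) (J h)] = '[col hA w, col hA (adj S' h)].
    apply: l2_dot_ext => i; rewrite !colE VJ.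
    have [_ _ ->] := mP i; rewrite -!adjP; congr ('[_, _]).
    by rewrite -[LHS]SK ST !SK'.
  by rewrite -row_dot /hA (cuntz_row_col cA) -adjP.
Qed.

Let M := cuntz_space V.
Let Y : {bounded sub_of M -> H} := adj J \o incl M.
Let X : {bounded H -> sub_of M} := adj Y.

(** The vectors of the previous lemma keep h away from the complements of all
    levels, uniformly in k, and these complements exhaust the complement of the
    Cuntz space. *)
Lemma to_cuntz_bounded_below : exists2 c : R, 0 < c & forall h, nr h <= c * nr (X h).
Proof.
have [C C0 S'C] := boundedP S'; have [D D0 SD] := boundedP S.
exists (C * D); first exact: mulr_gt0.
move=> h; pose p : K := sub_val (X h).
have ortho x : (M : set K) x -> '[x, J h - p] = 0.
  move=> Mx; pose x' : sub_of M := SubOf (mem_set Mx).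
  by rewrite hdotBr -[ '[x, p]]/('[x', X h]) -adjP /Y /= -adjPr subrr.
apply/ler_addgt0Pr => e e0.
have eCD : 0 < e / (C * D) by rewrite divr_gt0 ?mulr_gt0.
have [k [u uk yu]] := cuntz_ortho_approx ortho eCD.
have [m [mk mC mJ]] := level_preimage C0 S'C k (S h).
have [->|h0] := eqVneq h 0.
  by rewrite nr0 addr_ge0 ?mulr_ge0 ?nr_ge0 ?(ltW C0) ?(ltW D0) ?(ltW e0).
have n0 : 0 < nr h.
  by rewrite lt_def nr_ge0 andbT; apply: contra h0 => /eqP h1; apply/eqP/nr_eq0; rewrite h1.
have hh : '[m, J h - u] = '[h, h] by rewrite hdotBr uk // subr0 mJ SK.
have : complex.Re '[h, h] <= nr m * nr (J h - u).
  by rewrite -hh; apply: le_trans (nr_CS _ _); apply: le_trans (ler_norm _) (normC_ge_Re _).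
rewrite hdot_nr /= => h1.
have h2 : nr (J h - u) <= nr (X h) + e / (C * D).
  have := nrD p (J h - p - u); rewrite addrA (addrC p) subrK => h3.
  by apply: le_trans h3 _; rewrite lerD // ltW.
have h3 : nr m <= C * D * nr h.
  by apply: le_trans mC _; rewrite -mulrA ler_wpM2l ?(ltW C0).
have := le_trans h1 (ler_pM (nr_ge0 _) (nr_ge0 _) h3 h2).
rewrite expr2 mulrAC ler_pM2r // mulrDr => h4; apply: le_trans h4 _.
by rewrite lerD2l mulrC divfK // mulf_neq0 // gt_eqF.
Qed.

(** The compression Y of the Cuntz space to H intertwines the Cuntz part U with
    T, so Z = S Y intertwines the Cuntz row isometries U and A.  Then also
    U_i Z^* = Z^* A_i, because every U_j^* gives the same value on both sides;
    hence ker Z = ker Y reduces U.  Being orthogonal to H, it is zero by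
    minimality.  Since Y^* is bounded below, it is invertible, and so is Y. *)
Lemma cuntz_part_similar : jointly_similar T (cuntz_part oV).
Proof.
pose U := cuntz_part oV.
have adjJV i x : adj J (V i x) = T i (adj J x).
  by apply: hdot_inj => z; rewrite -adjPr adjP VJ (adjP (T i)) -adjPr.
have YU i r : Y (U i r) = T i (Y r) by exact: adjJV.
pose Z : {bounded sub_of M -> W} := S \o Y.
have ZU i r : Z (U i r) = A i (Z r) by rewrite /Z /= -ST; congr (S _); exact: YU.
have oA : orth_isometries A by exact: cuntz_orth.
have UU i j r : adj (U j) (U i r) = if j == i then r else 0.
  apply: val_inj; rewrite /= (cuntz_part_adj oV) /= orth_adj //; by case: ifP.
have UZ i w : U i (adj Z w) = adj Z (A i w).
  apply/subr0_eq; apply: (@cuntz_part_ker _ _ _ _ oV) => j; rewrite raddfB /= UU.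
  have -> : adj (U j) (adj Z (A i w)) = adj Z (adj (A j) (A i w)).
    by apply: hdot_inj => r; rewrite -!adjPr ZU.
  by rewrite orth_adj //; case: ifP => _; rewrite ?(linear0 (adj Z)) subrr.
have Yker i r : Y r = 0 -> Y (adj (U i) r) = 0.
  move=> Yr; have Zr : Z r = 0 by rewrite /Z /= [adj J _]Yr linear0.
  apply: (can_inj SK); rewrite linear0 -/(Z _); apply: hdot_inj => w.
  by rewrite hdot0l (adjP Z) -(adjPr (U i)) UZ -(adjP Z) Zr hdot0l.
have Yinj r : Y r = 0 -> r = 0.
  move=> Yr; apply: val_inj; apply: cyc => w h; elim: w r Yr => [|i w IH] r Yr /=.
    by rewrite adjP [adj J _]Yr hdot0r.
  by rewrite adjP -(cuntz_part_adj oV) IH //; exact: Yker.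
have [c c0 Xc] := to_cuntz_bounded_below.
have [X' [XK XK']] : exists g : {bounded sub_of M -> H}, cancel X g /\ cancel g X.
  apply: bounded_below_inv c0 Xc _ => y Xy; apply: Yinj; apply: hdot_inj => h.
  by rewrite hdot0l adjP hdotC Xy conjC0.
exists (adj X' : {bounded H -> sub_of M}), Y.
have YX' : cancel (adj X') Y.
  by move=> h; apply: hdot_inj => z; rewrite adjP -adjPr XK.
have X'Y : cancel Y (adj X').
  by move=> r; apply: hdot_inj => z; rewrite -adjPr adjP XK'.
by split=> // i h; apply: (can_inj X'Y); rewrite YX' YU YX'.
Qed.

End Similarity.

(** * Creation operators on the full Fock space *)

Section FockTheory.
Variables (R : realType) (I : choiceType).
Implicit Types (E : hilbertType R).

Lemma adj_tensb E (J : choiceType) (j : J) (x : l2 J E) : adj (tensb E j) x = x j.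
Proof.
by apply: adj_uniq => e; rewrite hdotC (dot_tens x j e) -hdotC.
Qed.

Lemma tens_cons E (i : I) (w : seq I) (e : E) :
  creat i (tens (l2_basis w) e) = tens (l2_basis (i :: w : seq I)) e.
Proof. by rewrite creat_tens creat_basis. Qed.

Lemma creat_linear E i : linear (@creat R I E i).
Proof.
move=> a x y; apply: l2P => -[|j w]; rewrite l2DE l2ZE /=; first by rewrite scaler0 addr0.
by case: ifP => _ //; rewrite scaler0 addr0.
Qed.

Lemma tens_cons_orth E (i : I) :
  orth_isometries (fun w : seq I => tensb E (i :: w)).
Proof.
move=> v w x y; rewrite [LHS]dot_tens tens_basisE eqseq_cons eqxx /= eq_sym.
by case: ifP => // _; rewrite hdot0l.
Qed.

(** Creation by i sends the basis vector of w to that of i :: w, so it is the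
    row operator of an orthogonal family of isometries; its boundedness and
    its adjoint come from the general theory of such families. *)
Lemma creat_row E i (x : fock I E) : creat i x = row (orth_row_contr (@tens_cons_orth E i)) x.
Proof.
apply: l2P => v; apply: hdot_inj => e; rewrite -[RHS]dot_tens row_dot.
case: v => [|j v] /=.
  rewrite hdot0l; apply/esym/l2_dot0 => w.
  by rewrite colE adj_tensb tens_basisE hdot0r.
have [<-|ji] := eqVneq j i.
  rewrite -[LHS](dot_tens x v); apply: l2_dot_ext => w.
  by rewrite colE adj_tensb !tens_basisE eqseq_cons eqxx.
rewrite hdot0l; apply/esym/l2_dot0 => w.
by rewrite colE adj_tensb tens_basisE eqseq_cons eq_sym (negPf ji) hdot0r.
Qed.

Lemma creat_dot E i (x y : fock I E) : '[creat i x, creat i y] = '[x, y].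
Proof. by rewrite !creat_row orth_row_dot. Qed.

Lemma creat_nr E i (x : fock I E) : nr (creat i x) <= 1 * nr x.
Proof. by rewrite mul1r creat_row; exact: row_contr_nr. Qed.

Definition creatb E i : {bounded fock I E -> fock I E} :=
  bounded_of (@creat_linear E i) (@creat_nr E i).

Lemma creat_orth E : orth_isometries (creatb E).
Proof.
move=> i j x y; case: eqVneq => [<-|ij]; first exact: creat_dot.
apply: l2_dot0 => -[|k w] /=; first by rewrite hdot0l.
case: eqVneq => [->|_]; last by rewrite hdot0l.
by rewrite (negPf ij) hdot0r.
Qed.

Lemma adj_creat E i (x : fock I E) w : adj (creatb E i) x w = x (i :: w).
Proof.
apply: hdot_inj => e; rewrite -[LHS]dot_tens -(adjPr (creatb E i)) /=.
by rewrite tens_cons dot_tens.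
Qed.

Definition colS E : {bounded fock I E -> l2 I (fock I E)} := col (orth_row_contr (@creat_orth E)).
Definition rowS E : {bounded l2 I (fock I E) -> fock I E} := row (orth_row_contr (@creat_orth E)).

Lemma colS_rowS E y : colS E (rowS E y) = y.
Proof. exact: orth_col_row. Qed.

Lemma colSE E (x : fock I E) i w : colS E x i w = x (i :: w).
Proof. by rewrite [colS E x i]colE adj_creat. Qed.

Lemma rowS_cons E y i w : rowS E y (i :: w) = y i w.
Proof. by rewrite -colSE colS_rowS. Qed.

Lemma rowS_nil E y : rowS E y [::] = 0.
Proof.
apply: hdot_inj => e; rewrite hdot0l -[LHS]dot_tens row_dot; apply: l2_dot0 => i.
rewrite colE (_ : adj _ _ = 0) ?hdot0r //.
by apply: l2P => w; rewrite adj_creat tens_basisE.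
Qed.

(** A vector is the sum of its vacuum component and of its parts in the ranges
    of the creation operators. *)
Lemma fock_split E (x : fock I E) :
  x = tens (l2_basis [::]) (x [::]) + rowS E (colS E x).
Proof.
apply: l2P => -[|i w]; rewrite l2DE tens_basisE /=; first by rewrite rowS_nil addr0.
by rewrite add0r rowS_cons colSE.
Qed.

Lemma fock_dot E (x y : fock I E) :
  '[x, y] = '[x [::], y [::]] + '[colS E x, colS E y].
Proof.
rewrite {1}(fock_split x) hdotDl row_dot; congr (_ + _).
by rewrite hdotC dot_tens -hdotC.
Qed.

Lemma fock_bounded_ext E (L : hilbertType R) (f g : {bounded fock I E -> L}) :
  (forall e, f (tens (l2_basis [::]) e) = g (tens (l2_basis [::]) e)) ->
  (forall i x, f (creat i x) = g (creat i x)) -> f =1 g.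
Proof.
move=> fg0 fgS; apply: l2_bounded_ext => -[|i w] e; first exact: fg0.
by rewrite -tens_cons; exact: fgS.
Qed.

Lemma fock_incl_linear (H : hilbertType R) (M : subspace H) : linear (@fock_incl R I H M).
Proof. by move=> a x y; apply: l2P. Qed.

Lemma fock_incl_dot (H : hilbertType R) (M : subspace H) (x y : fock I (sub_of M)) :
  '[fock_incl x, fock_incl y] = '[x, y].
Proof. exact: l2_dot_ext. Qed.

Lemma fock_incl_nr (H : hilbertType R) (M : subspace H) (x : fock I (sub_of M)) :
  nr (fock_incl x) <= 1 * nr x.
Proof.
rewrite mul1r; apply: l2_nr_le (nr_ge0 _) => A; rewrite -hdot_nr.
exact: (l2_partial_le x A).
Qed.

Definition fincl (H : hilbertType R) (M : subspace H) : {bounded fock I (sub_of M) -> fock I H} :=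
  bounded_of (@fock_incl_linear H M) (@fock_incl_nr H M).

Lemma fincl_creat (H : hilbertType R) (M : subspace H) i (x : fock I (sub_of M)) :
  fincl M (creat i x) = creat i (fincl M x).
Proof. by apply: l2P => -[|j w] //=; case: ifP. Qed.

End FockTheory.
Arguments tensb {R I} E i.
Arguments creatb {R I} E i.
Arguments creat_orth {R I} E.
Arguments colS {R I} E.
Arguments rowS {R I} E.
Arguments fincl {R I H} M.

(** * Words in a family of isometries *)

Section Words.
Variables (R : realType) (n : option nat) (K : hilbertType R).
Variable V : optuple n K.

Fixpoint wordop (w : seq (gen n)) : {bounded K -> K} :=
  if w is i :: v then (V i \o wordop v : {bounded K -> K}) else (idfun : {bounded K -> K}).

Lemma wordopE w : wordop w = opword V w :> (K -> K).
Proof. by elim: w => //= i w ->. Qed.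

Lemma adj_opword_cons i w x : adj (opword V (i :: w)) x = adj (opword V w) (adj (V i) x).
Proof. by rewrite -!wordopE -adj_comp. Qed.

Lemma adj_opword_nil x : adj (opword V [::]) x = x.
Proof. by rewrite -wordopE; apply: adj_uniq. Qed.

Lemma opword_orth : orth_isometries V ->
  forall k (v w : k.-tuple (gen n)) x y,
  '[opword V v x, opword V w y] = if v == w then '[x, y] else 0.
Proof.
move=> oV; elim=> [|k IH] v w x y; first by rewrite (tuple0 v) (tuple0 w) eqxx.
case/tupleP: v => i v; case/tupleP: w => j w /=; rewrite oV.
rewrite -val_eqE /= eqseq_cons; case: eqVneq => //= _; exact: IH.
Qed.

Hypothesis oV : orth_isometries V.

Lemma wordop_orth k : orth_isometries (fun w : k.-tuple (gen n) => wordop w).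
Proof. by move=> v w x y; rewrite !wordopE; exact: opword_orth. Qed.

(** On level k the isometries V_w with w of length k satisfy the Parseval
    identity, since the projection onto their ranges fixes each V_w y. *)
Lemma level_parseval k x : (level V k : set K) x ->
  partial_sum (fun w : k.-tuple (gen n) => '[adj (opword V w) x, adj (opword V w) x])
    @ totally --> '[x, x].
Proof.
move=> xk; have hw := orth_row_contr (@wordop_orth k).
have xx : row hw (col hw x) = x.
  apply/subr0_eq; pose D : {bounded K -> K} := (row hw \o col hw) \- idfun.
  apply: (@level_ind _ _ _ V k (ker_subspace D)) xk => w y wk.
  suff e : row hw (col hw (opword V w y)) = opword V w y by rewrite /= e subrr.
  have -> : opword V w = wordop (Tuple (introT eqP wk)) by rewrite wordopE.
  rewrite (_ : col hw _ = tens (l2_basis (Tuple (introT eqP wk))) y) ?row_tens //.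
  apply: l2P => v; rewrite colE tens_basisE -[LHS]/(adj _ (wordop (Tuple (introT eqP wk)) y)).
  exact: (orth_adj (@wordop_orth k)).
rewrite -{3}xx row_dot; have := @l2_dot_cvg _ _ _ (col hw x) (col hw x).
set u := partial_sum _; rewrite (_ : u = partial_sum
  (fun w : k.-tuple (gen n) => '[adj (opword V w) x, adj (opword V w) x])) //.
by rewrite /u; congr partial_sum; apply/funext => w; rewrite -wordopE.
Qed.

End Words.

(** * Direct sums *)

(** The product type already carries the maximum norm, so the Hilbert space
    direct sum needs a type of its own. *)
Section HSum.
Variables (R : realType) (H1 H2 : hilbertType R).

Definition hsum : Type := (H1 * H2)%type.

HB.instance Definition _ := GRing.Lmodule.copy hsum (H1 * H2)%type.

Implicit Types x y : hsum.

Definition hsum_dot x y : R[i] := '[x.1, y.1] + '[x.2, y.2].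

Lemma hsum_dot_bilinear : bilinear_for
  (GRing.Scale.Law.clone _ _ ( *%R) _)
  (GRing.Scale.Law.clone _ _ (Num.conj \; *%R) _) hsum_dot.
Proof.
split=> u a x y; rewrite /hsum_dot /=.
  by rewrite !hdotDl !hdotZl mulrDr addrACA.
by rewrite !hdotDr !hdotZr mulrDr addrACA.
Qed.
HB.instance Definition _ := bilinear_isBilinear.Build _ _ _ _ _ _ hsum_dot hsum_dot_bilinear.

Lemma hsum_dot_herm x y : hsum_dot x y = (-1) ^+ false * (hsum_dot y x)^*.
Proof. by rewrite expr0 mul1r /hsum_dot rmorphD /= -!hdotC. Qed.
HB.instance Definition _ := isHermitianSesquilinear.Build _ _ _ _ hsum_dot hsum_dot_herm.

Lemma hsum_dot_gt0 (u : hsum) : u != 0 -> 0 < hsum_dot u u.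
Proof.
move=> u0; rewrite lt_def /hsum_dot !hdot_norm addr_ge0 ?exprn_ge0 // andbT.
apply: contra u0; rewrite paddr_eq0 ?exprn_ge0 // !expf_eq0 /= !normr_eq0.
by case: u => a b /= /andP[/eqP -> /eqP ->].
Qed.
HB.instance Definition _ := isDotProduct.Build _ _ hsum_dot hsum_dot_gt0.

HB.instance Definition _ := Lmodule_isNormed.Build R[i] hsum
  (dnormD hsum_dot) (dnormZ hsum_dot) (@dnorm_eq0 _ _ hsum_dot).

Lemma hsum_dot_norm x : hsum_dot x x = `|x| ^+ 2.
Proof. by rewrite -dnorm_sqr. Qed.

Lemma hsum_norm_sqr x : nr x ^+ 2 = nr x.1 ^+ 2 + nr x.2 ^+ 2.
Proof.
have := hsum_dot_norm x; rewrite /hsum_dot !hdot_nr nrE -rmorphXn -rmorphD.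
by move=> /(congr1 (@complex.Re R)).
Qed.

Lemma hsum_norm1 x : nr x.1 <= nr x.
Proof.
by rewrite -(ler_pXn2r (n := 2)) ?nnegrE ?nr_ge0 // (hsum_norm_sqr x) lerDl sqr_ge0.
Qed.

Lemma hsum_norm2 x : nr x.2 <= nr x.
Proof.
by rewrite -(ler_pXn2r (n := 2)) ?nnegrE ?nr_ge0 // (hsum_norm_sqr x) lerDr sqr_ge0.
Qed.

Lemma hsum_norm_le x : nr x <= nr x.1 + nr x.2.
Proof.
rewrite -(ler_pXn2r (n := 2)) ?nnegrE ?addr_ge0 ?nr_ge0 // (hsum_norm_sqr x) sqrrD.
by rewrite addrAC lerDl mulrn_wge0 // mulr_ge0 ?nr_ge0.
Qed.

Lemma hsum_complete (F : set_system hsum) : ProperFilter F -> cauchy F -> cvg F.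
Proof.
move=> FF Fc.
have part (V : completeNormedModType R[i]) (p : hsum -> V) :
    (forall x y, nr (p x - p y) <= nr (x - y)) -> cvg (p x @[x --> F]).
  move=> pc; apply/cauchy_cvgP/cauchyP => e e0.
  have /cauchyP/(_ e e0)[x0 Fx] := Fc; exists (p x0).
  suff : F (p @^-1` ball (p x0) e) by [].
  apply: filterS Fx => x; rewrite /preimage -!ball_normE /ball_ /=.
  by apply: le_lt_trans; rewrite !nrE lecR; exact: pc.
have /cvg_ex[a /cvgrPdist_lt Fa] := part H1 fst (fun x y => hsum_norm1 (x - y)).
have /cvg_ex[b /cvgrPdist_lt Fb] := part H2 snd (fun x y => hsum_norm2 (x - y)).
apply/cvg_ex; exists ((a, b) : hsum); apply/cvgrPdist_lt => e e0.
have e2 : 0 < e / 2 by rewrite divr_gt0.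
apply: filterS2 (Fa _ e2) (Fb _ e2) => x xa xb.
rewrite [ltRHS]splitr; apply: le_lt_trans (ltrD xa xb).
by rewrite !nrE -rmorphD lecR; exact: (hsum_norm_le ((a, b) - x)).
Qed.
HB.instance Definition _ := Uniform_isComplete.Build hsum hsum_complete.
HB.instance Definition _ := NormedModule_isHilbert.Build R hsum hsum_dot_norm.

Lemma hsum_dotE (x y : hsum) : '[x, y] = '[x.1, y.1] + '[x.2, y.2].
Proof. by []. Qed.

Lemma hfst_linear : linear (fst : hsum -> H1). Proof. by []. Qed.
Lemma hsnd_linear : linear (snd : hsum -> H2). Proof. by []. Qed.

Lemma hfst_nr (x : hsum) : nr x.1 <= 1 * nr x.
Proof. by rewrite mul1r; exact: hsum_norm1. Qed.
Lemma hsnd_nr (x : hsum) : nr x.2 <= 1 * nr x.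
Proof. by rewrite mul1r; exact: hsum_norm2. Qed.

Definition hfst : {bounded hsum -> H1} := bounded_of hfst_linear hfst_nr.
Definition hsnd : {bounded hsum -> H2} := bounded_of hsnd_linear hsnd_nr.

Lemma hinl_linear : linear (fun h : H1 => (h, 0) : hsum).
Proof.
move=> a x y; transitivity ((a *: x + y, a *: 0 + 0) : hsum) => //.
by rewrite scaler0 addr0.
Qed.
Lemma hinr_linear : linear (fun h : H2 => (0, h) : hsum).
Proof.
move=> a x y; transitivity ((a *: 0 + 0, a *: x + y) : hsum) => //.
by rewrite scaler0 addr0.
Qed.

Lemma hinl_nr h : nr ((h, 0) : hsum) <= 1 * nr h.
Proof. by apply: le_trans (hsum_norm_le _) _; rewrite /= nr0 addr0 mul1r. Qed.
Lemma hinr_nr h : nr ((0, h) : hsum) <= 1 * nr h.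
Proof. by apply: le_trans (hsum_norm_le _) _; rewrite /= nr0 add0r mul1r. Qed.

Definition hinl : {bounded H1 -> hsum} := bounded_of hinl_linear hinl_nr.
Definition hinr : {bounded H2 -> hsum} := bounded_of hinr_linear hinr_nr.

Lemma hinl_isometry : isometry_op hinl.
Proof.
move=> h; rewrite !nrE; congr (_%:C)%C; apply/le_anti; rewrite (hsum_norm1 (hinl h)) andbT.
by rewrite -[leRHS]mul1r; exact: hinl_nr.
Qed.

End HSum.

(** * Unitary operators between closures of ranges *)

Section RangeMaps.
Variable R : realType.
Implicit Types F G : hilbertType R.

Lemma to_range_linear F G (f : {bounded F -> G}) : linear (to_range f).
Proof. by move=> a x y; apply: val_inj => /=; rewrite linearP. Qed.

Lemma to_range_bounded F G (f : {bounded F -> G}) :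
  exists M : R[i], forall x, `|to_range f x| <= M * `|x|.
Proof. by have [M _ fM] := boundedP f; apply: (@nr_bound _ _ _ _ M). Qed.

HB.instance Definition _ F G (f : {bounded F -> G}) :=
  GRing.isLinear.Build R[i] F (sub_of (cl_range f)) _ (to_range f) (to_range_linear f).
HB.instance Definition _ F G (f : {bounded F -> G}) :=
  isBounded.Build R F (sub_of (cl_range f)) (to_range f) (to_range_bounded f).

Lemma cl_range_ortho F G (f : {bounded F -> G}) z :
  (forall x, '[f x, z] = 0) -> forall y, (cl_range f : set G) y -> '[y, z] = 0.
Proof.
move=> fz y /closure_normP yf.
apply: (subspace_closed (M := ker_subspace (dotl z))) => e e0.
have [|_ [x _ <-] yx] := yf e%:C%C; first by rewrite ltcR.
by exists (f x); [exact: fz|move: yx; rewrite nrE ltcR].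
Qed.

Lemma to_range_dense F G (f : {bounded F -> G}) (z : sub_of (cl_range f)) :
  (forall x, '[to_range f x, z] = 0) -> z = 0.
Proof.
move=> fz; apply: hdot_eq0; rewrite -[LHS]/('[sub_val z, sub_val z]).
apply: cl_range_ortho (set_mem (valP z)); exact: fz.
Qed.

(** Two maps with dense ranges that have the same inner products differ by a
    unitary operator: the closure of their joint graph projects isometrically,
    up to a constant, onto both factors. *)
Lemma unitary_of_dots F G1 G2 (f : {bounded F -> G1}) (g : {bounded F -> G2}) :
  (forall x y, '[f x, f y] = '[g x, g y]) ->
  (forall z, (forall x, '[f x, z] = 0) -> z = 0) ->
  (forall z, (forall x, '[g x, z] = 0) -> z = 0) ->
  exists (P : {bounded G1 -> G2}) (P' : {bounded G2 -> G1}),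
    [/\ cancel P P', cancel P' P, forall x, P (f x) = g x &
        forall x y, '[P x, P y] = '[x, y]].
Proof.
move=> fg fd gd.
pose h : {bounded F -> hsum G1 G2} := (@hinl R G1 G2 \o f) \+ (@hinr R G1 G2 \o g).
have hE x : h x = (f x, g x).
  by transitivity ((f x + 0, 0 + g x) : hsum G1 G2) => //; rewrite addr0 add0r.
pose N := cl_range h.
have dots (z w : sub_of N) : '[(val z).1, (val w).1] = '[(val z).2, (val w).2].
  (* z is orthogonal to s w iff the components of z and w have equal products;
     in this form the property passes to the closure of the graph. *)
  pose s (w : hsum G1 G2) : hsum G1 G2 := (w.1, - w.2).
  have sE (z' w' : hsum G1 G2) : '[z', s w'] = '[z'.1, w'.1] - '[z'.2, w'.2].
    by rewrite hsum_dotE /= linearNr.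
  have h1 x (w' : hsum G1 G2) : (N : set _) w' -> '[f x, w'.1] = '[g x, w'.2].
    move=> Nw; apply/subr0_eq; rewrite hdotC [ '[g x, _]]hdotC -rmorphB /=.
    have <- : '[w', s (h x)] = '[w'.1, f x] - '[w'.2, g x] by rewrite sE hE.
    rewrite (cl_range_ortho _ Nw) ?conjC0 // => y.
    by rewrite sE !hE /= fg subrr.
  apply/subr0_eq; rewrite -sE; apply: cl_range_ortho (set_mem (valP z)) => x.
  by rewrite sE hE /= (h1 _ _ (set_mem (valP w))) subrr.
have nrs (z : sub_of N) : nr (val z).1 = nr (val z).2.
  have := dots z z; rewrite !hdot_nr => -[] /eqP.
  by rewrite eqrXn2 ?nr_ge0 // => /eqP.
pose p1 : {bounded sub_of N -> G1} := @hfst R G1 G2 \o incl N.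
pose p2 : {bounded sub_of N -> G2} := @hsnd R G1 G2 \o incl N.
have p1E x : p1 (to_range h x) = f x by rewrite -[LHS]/((h x).1) hE.
have p2E x : p2 (to_range h x) = g x by rewrite -[LHS]/((h x).2) hE.
have nle (z : sub_of N) : nr z <= nr (val z).1 + nr (val z).2 := hsum_norm_le (val z).
have two : 0 < (2 : R) by [].
have [q1 [pq1 qp1]] : exists q : {bounded G1 -> sub_of N}, cancel p1 q /\ cancel q p1.
  apply: (bounded_below_inv two) => [z|y py].
    by apply: le_trans (nle z) _; rewrite -nrs -mulr2n mulr_natl.
  by apply: fd => x; rewrite -p1E; exact: py.
have [q2 [pq2 qp2]] : exists q : {bounded G2 -> sub_of N}, cancel p2 q /\ cancel q p2.
  apply: (bounded_below_inv two) => [z|y py].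
    by apply: le_trans (nle z) _; rewrite nrs -mulr2n mulr_natl.
  by apply: gd => x; rewrite -p2E; exact: py.
exists (p2 \o q1 : {bounded G1 -> G2}), (p1 \o q2 : {bounded G2 -> G1}).
have dotp (z w : sub_of N) : '[p1 z, p1 w] = '[p2 z, p2 w] by exact: dots.
clearbody p1 p2; split=> [x|x|x|x y] /=.
- by rewrite pq2 qp1.
- by rewrite pq1 qp2.
- by rewrite -p1E pq1 p2E.
- by rewrite -dotp !qp1.
Qed.

End RangeMaps.

(** * The defect operators of a row contraction *)

Section Defect.
Variables (R : realType) (n : option nat) (H : hilbertType R).
Variable T : optuple n H.
Hypothesis hT : row_contr T.

Local Notation rowT := (row hT).
Local Notation colT := (col hT).
Local Notation D := (defect T).
Local Notation Ds := (defect_star T).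

Lemma defectE : D = op_sqrt (fun x => x - adj rowT (rowT x)).
Proof.
by rewrite /defect (_ : row_op T = rowT) //; apply/funext => x; exact: sum_rowE.
Qed.

Lemma defect_starE : Ds = op_sqrt (fun h => h - adj colT (colT h)).
Proof.
by rewrite /defect_star; congr op_sqrt; apply/funext => h; rewrite (TTstarE hT).
Qed.

Lemma defect_sym x y : '[D x, y] = '[x, D y].
Proof. by rewrite defectE; exact: (op_sqrt_sym (row_contr_nr hT)). Qed.

Lemma defect_star_sym x y : '[Ds x, y] = '[x, Ds y].
Proof. by rewrite defect_starE; exact: (op_sqrt_sym (col_contr hT)). Qed.

Lemma defect_dot x y : '[D x, D y] = '[x, y] - '[rowT x, rowT y].
Proof. by rewrite defectE; exact: (op_sqrt_dot (row_contr_nr hT)). Qed.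

Lemma defect_star_dot x y : '[Ds x, Ds y] = '[x, y] - '[colT x, colT y].
Proof. by rewrite defect_starE; exact: (op_sqrt_dot (col_contr hT)). Qed.

Lemma row_defect x : rowT (D x) = Ds (rowT x).
Proof.
rewrite defectE defect_starE (op_sqrt_intertwine (row_contr_nr hT)).
suff -> : (fun y => y - adj (adj rowT) (adj rowT y)) = (fun h => h - adj colT (colT h)) by [].
by apply/funext => h; rewrite (adjK rowT) (adjK colT).
Qed.

(** The cross terms cancel because T D = Ds T. *)
Lemma halmos_isometry h k d e :
  '[Ds h - rowT d, Ds k - rowT e] + '[colT h + D d, colT k + D e] =
  '[h, k] + '[d, e].
Proof.
rewrite !hdotBl !hdotBr !hdotDl !hdotDr defect_star_dot defect_dot.
have -> : '[colT h, D e] = '[Ds h, rowT e].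
  by rewrite hdotC -row_dot row_defect -hdotC -defect_star_sym.
have -> : '[D d, colT k] = '[rowT d, Ds k].
  by rewrite -row_dot row_defect defect_star_sym.
ring.
Qed.

(** * The Poisson kernel *)

(** Cut off at words of length m, the square norm of the Poisson transform is
    built up from |Ds h|^2 = |h|^2 - sum_i |T_i^* h|^2 and the transforms of the
    T_i^* h cut off at length m - 1; the sum stays below |h|^2. *)
Lemma poisson_partial m h : exists x : fock (gen n) H, nr x <= nr h /\
  forall w, (size w < m)%N -> x w = Ds (adj (opword T w) h).
Proof.
elim: m h => [|m IH] h; first by exists 0; rewrite nr0 nr_ge0.
have /choice[x xP] := fun i => IH (adj (T i) h).
have xin : x \in @sq_summable R (gen n) (fock (gen n) H).
  apply/asboolP; exists (`|h| ^+ 2) => A; apply: le_trans (hT h A).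
  by apply: ler_sum => i _; rewrite ler_pXn2r ?nnegrE // !nrE lecR; exact: (xP i).1.
pose y : l2 (gen n) (fock (gen n) H) := L2 xin.
have ny : nr y <= nr (colT h).
  apply: l2_nr_le (nr_ge0 _) => A; rewrite -hdot_nr; apply: le_trans (l2_partial_le (colT h) A).
  by apply: ler_sum => i _; rewrite ler_pXn2r ?nnegrE // !nrE lecR; exact: (xP i).1.
exists (tens (l2_basis [::]) (Ds h) + rowS H y).
have nil : (tens (l2_basis [::]) (Ds h) + rowS H y) [::] = Ds h.
  by rewrite l2DE tens_basisE eqxx rowS_nil addr0.
have cons i w : (tens (l2_basis [::]) (Ds h) + rowS H y) (i :: w) = x i w.
  by rewrite l2DE tens_basisE rowS_cons add0r.
split=> [|[_|i w]].
- apply: nr_le_sqr; rewrite -lecR -!hdot_nr fock_dot nil.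
  have -> : colS H (tens (l2_basis [::]) (Ds h) + rowS H y) = y.
    by apply: l2P => i; apply: l2P => w; rewrite colSE cons.
  rewrite defect_star_dot -[leRHS](subrK '[colT h, colT h]) lerD2l.
  by rewrite !hdot_nr lecR ler_pXn2r ?nnegrE ?nr_ge0.
- by rewrite nil adj_opword_nil.
- by rewrite ltnS cons adj_opword_cons; exact: (xP i).2.
Qed.

Lemma poisson_sum_le h (A : {fset seq (gen n)}) :
  \sum_(w <- A) `|Ds (adj (opword T w) h)| ^+ 2 <= (nr h ^+ 2)%:C%C.
Proof.
pose m := (\max_(w <- A) size w).+1.
have [x [xh xw]] := poisson_partial m h.
apply: (@le_trans _ _ (nr x ^+ 2)%:C%C); last by rewrite lecR ler_pXn2r ?nnegrE ?nr_ge0.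
rewrite -hdot_nr; apply: le_trans (l2_partial_le x A).
rewrite big_seq [leRHS]big_seq; apply: ler_sum => w wA; rewrite xw //.
by rewrite /m ltnS (big_fsetD1 w) //= leq_maxl.
Qed.

Lemma poisson_in h : (fun w => Ds (adj (opword T w) h)) \in @sq_summable R (seq (gen n)) H.
Proof. by apply/asboolP; exists (nr h ^+ 2)%:C%C => A; exact: poisson_sum_le. Qed.

Definition poisson_fun h : fock (gen n) H := L2 (poisson_in h).

Lemma poisson_linear : linear poisson_fun.
Proof.
move=> a x y; apply: l2P => w; rewrite l2DE l2ZE /= -wordopE.
by rewrite !linearP.
Qed.

Lemma poisson_nr h : nr (poisson_fun h) <= 1 * nr h.
Proof.
by rewrite mul1r; apply: l2_nr_le (nr_ge0 _) => A; exact: poisson_sum_le.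
Qed.

Definition poisson : {bounded H -> fock (gen n) H} := bounded_of poisson_linear poisson_nr.

Lemma poissonE h w : poisson h w = Ds (adj (opword T w) h).
Proof. by []. Qed.

Lemma poisson_adj_creat i h : adj (creatb H i) (poisson h) = poisson (adj (T i) h).
Proof. by apply: l2P => w; rewrite adj_creat !poissonE adj_opword_cons. Qed.

(** * The coefficients of the characteristic function *)

Variable Theta : {bounded fock (gen n) (defect_space T) -> fock (gen n) (defect_star_space T)}.
Hypothesis cT : is_char_fun Theta.

Local Notation DT := (defect_space T).
Local Notation Th := (fincl (cl_range Ds) \o Theta).

(** With the Poisson kernel for f, this makes the outer sum in the equation of the
    characteristic function converge. *)
Lemma pointwise_in (E F : hilbertType R) (I : choiceType) (f : {bounded E -> F}) (x : l2 I E) :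
  (fun i => f (x i)) \in @sq_summable R I F.
Proof.
have [M M0 fM] := boundedP f; apply/asboolP; exists ((M ^+ 2)%:C%C * '[x, x]) => A.
apply: le_trans (ler_wpM2l _ (l2_partial_le x A)); last by rewrite lecR sqr_ge0.
rewrite mulr_sumr; apply: ler_sum => i _.
by rewrite !nr_sqr_normE -rmorphM lecR -exprMn ler_pXn2r ?nnegrE ?mulr_ge0 ?nr_ge0 ?(ltW M0).
Qed.

(** The two nested sums of the equation for the characteristic function converge:
    the inner ones to Poisson transforms and the outer one to a row operator. *)
Lemma char_fun_vac d : Th (tens (l2_basis [::]) d) =
  - tens (l2_basis [::]) (rowT (val d)) + rowS H (L2 (pointwise_in poisson (D (val d)))).
Proof.
have [_ _ h] := cT; apply: etrans (h d) _.
rewrite -(sum_rowE hT) -[X in _ = _ + X]sum_rowE; congr (_ + summability.sum _).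
apply/funext => i /=; congr creat.
by have /cvg_lim := @tens_basis_cvg _ _ _ (poisson (D (val d) i)); apply; exact: norm_hausdorff.
Qed.

Lemma char_fun_creat i x : Th (creat i x) = creatb H i (Th x).
Proof.
have [_ h _] := cT; transitivity (fincl (cl_range Ds) (creat i (Theta x))).
  by congr (fincl _ _); exact: h.
exact: fincl_creat.
Qed.

Lemma char_fun_nil f : Th f [::] = - rowT (val (f [::])).
Proof.
pose g : {bounded fock (gen n) DT -> H} :=
  (\0 \- (rowT \o incl (cl_range D))) \o adj (tensb DT ([::] : seq (gen n))).
have gE x : g x = - rowT (val (x [::])).
  by transitivity (0 - rowT (val (adj (tensb DT ([::] : seq (gen n))) x))) => //;
     rewrite adj_tensb sub0r.
suff e : adj (tensb H ([::] : seq (gen n))) \o Th =1 g.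
  by rewrite -gE -e -[LHS]adj_tensb.
apply: fock_bounded_ext => [d|i x]; rewrite gE -[LHS]/(adj _ (Th _)) adj_tensb.
  by rewrite char_fun_vac l2DE l2NE !tens_basisE rowS_nil addr0 eqxx.
by rewrite char_fun_creat [RHS](_ : _ = - rowT 0) ?linear0 ?oppr0.
Qed.

(** On vacuum vectors this is the defining equation; on the ranges of the
    creation operators it says that Theta commutes with them. *)
Lemma char_fun_cons i f : adj (creatb H i) (Th f) =
  poisson (D (val (f [::])) i) + Th (adj (creatb DT i) f).
Proof.
pose ev0 := adj (tensb DT ([::] : seq (gen n))).
pose g : {bounded fock (gen n) DT -> fock (gen n) H} :=
  (poisson \o (adj (tensb H i) \o (D \o (incl (cl_range D) \o ev0))))
  \+ (Th \o adj (creatb DT i)).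
have gE x : g x = poisson (D (val (x [::])) i) + Th (adj (creatb DT i) x).
  transitivity (poisson (adj (tensb H i) (D (val (ev0 x)))) + Th (adj (creatb DT i) x)) => //.
  by rewrite /ev0 !adj_tensb.
suff e : adj (creatb H i) \o Th =1 g by rewrite -gE -e.
apply: fock_bounded_ext => [d|j x]; rewrite gE -[LHS]/(adj _ (Th _)).
  rewrite char_fun_vac tens_basisE eqxx; apply: l2P => w.
  rewrite adj_creat l2DE l2NE tens_basisE oppr0 add0r rowS_cons l2DE.
  rewrite (_ : adj (creatb DT i) _ = 0) ?linear0 ?addr0 //.
  by apply: l2P => v; rewrite adj_creat tens_basisE.
rewrite char_fun_creat (orth_adj (creat_orth H)) -[creat j x]/(creatb DT j x).
rewrite (orth_adj (creat_orth DT)).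
rewrite (_ : val (creatb DT j x [::]) = 0) // (linear0 D) l20E (linear0 poisson).
by rewrite add0r; case: ifP => // _; rewrite linear0.
Qed.

End Defect.

(** * The minimal isometric dilation on H (+) F^2 (x) D *)

Section Dilation.
Variables (R : realType) (n : option nat) (H : hilbertType R).
Variable T : optuple n H.
Hypothesis hT : row_contr T.

Local Notation rowT := (row hT).
Local Notation colT := (col hT).
Local Notation D := (defect T).
Local Notation Ds := (defect_star T).
Local Notation DT := (defect_space T).
Local Notation K := (hsum H (fock (gen n) DT)).

Definition vacuum : {bounded DT -> fock (gen n) DT} := tensb DT ([::] : seq (gen n)).

Definition to_defect : {bounded l2 (gen n) H -> DT} := to_range D.

(** The form of the dilation due to Schaeffer: V_i sends to the vacuum what T_i
    loses of a vector of H, and shifts the Fock space. *)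
Definition dilation (i : gen n) : {bounded K -> K} :=
  (hinl H (fock (gen n) DT) \o (T i \o hfst H (fock (gen n) DT))) \+
  (hinr H (fock (gen n) DT) \o
    ((vacuum \o (to_defect \o (tensb H i \o hfst H (fock (gen n) DT)))) \+
     (creatb DT i \o hsnd H (fock (gen n) DT)))).

Lemma dilationE i (x : K) :
  dilation i x = (T i x.1, vacuum (to_defect (tensb H i x.1)) + creat i x.2).
Proof.
transitivity ((T i x.1 + 0, 0 + (vacuum (to_defect (tensb H i x.1)) + creat i x.2)) : K) => //.
by rewrite addr0 add0r.
Qed.

Lemma vacuum_nil (d : DT) : vacuum d [::] = d.
Proof. exact: tens_basisE. Qed.

Lemma vacuum_dot (d : DT) (f : fock (gen n) DT) : '[vacuum d, f] = '[d, f [::]].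
Proof. by rewrite hdotC [ '[f, _]]dot_tens -hdotC. Qed.

Lemma to_defect_dot x (d : DT) : '[to_defect x, d] = '[x, D (val d)].
Proof. exact: (defect_sym hT x (val d)). Qed.

Lemma dilation_adj i (x : K) :
  adj (dilation i) x = (adj (T i) x.1 + D (val (x.2 [::])) i, adj (creatb DT i) x.2).
Proof.
apply: adj_uniq => y; rewrite dilationE !hsum_dotE /= hdotDl vacuum_dot to_defect_dot hdotDr adjP.
rewrite -[creat i y.2]/(creatb DT i y.2) adjP addrA; congr (_ + _ + _).
by rewrite [LHS]hdotC [ '[_, tensb H i _]]dot_tens -hdotC.
Qed.

Lemma dilation_orth : orth_isometries dilation.
Proof.
move=> i j x y; rewrite !dilationE hsum_dotE /= hdotDl !hdotDr !vacuum_dot vacuum_nil.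
rewrite [creat _ _ _]/= hdot0r addr0.
rewrite [ '[creat i x.2, vacuum _]]hdotC vacuum_dot [creat _ _ _]/= hdot0r conjC0 add0r.
rewrite -[ '[creat i x.2, _]]/('[creatb DT i x.2, creatb DT j y.2]) (creat_orth DT).
rewrite -[ '[to_defect _, to_defect _]]/('[D (tensb H i x.1), D (tensb H j y.1)]) (defect_dot hT).
rewrite !(row_tens hT) addrA addrCA subrr addr0 dot_tens tens_basisE eq_sym.
by case: ifP => _; rewrite ?hdot0l ?addr0 // hsum_dotE.
Qed.

Lemma dilation_compression i h : adj (dilation i) (hinl _ _ h) = hinl _ _ (adj (T i) h).
Proof.
rewrite dilation_adj; transitivity ((adj (T i) h + D 0 i, adj (creatb DT i) 0) : K) => //.
by rewrite (linear0 D) (linear0 (adj (creatb DT i))) l20E addr0.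
Qed.

(** A vector r orthogonal to all V_w H has no component in H.  The component in
    H of V_i^* r is then entry i of D applied to the vacuum component of r,
    which vanishes in turn; repeating this with V_i^* r covers all words. *)
Lemma dilation_cyclic (r : K) : (forall w h, '[opword dilation w (hinl _ _ h), r] = 0) -> r = 0.
Proof.
move=> hr.
have fst0 (s : K) : (forall h, '[hinl H (fock (gen n) DT) h, s] = 0) -> s.1 = 0.
  move=> hs; apply: hdot_eq0; have := hs s.1.
  by rewrite hsum_dotE /= hdot0l addr0.
have snd0 w : forall s : K, (forall w h, '[opword dilation w (hinl _ _ h), s] = 0) -> s.2 w = 0.
  elim: w => [|i w IH] s hs.
    have s1 := fst0 s (hs [::]).
    have Dz i : D (val (s.2 [::])) i = 0.
      have : (adj (dilation i) s).1 = 0.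
        by apply: fst0 => h; rewrite -adjP; exact: (hs [:: i] h).
      by rewrite dilation_adj s1 [(_, _).1]/= (linear0 (adj (T i))) add0r.
    apply: to_range_dense => x; rewrite [LHS](defect_sym hT) (_ : D _ = 0) ?hdot0r //.
    by apply: l2P => i; rewrite Dz.
  rewrite -(adj_creat i) (_ : adj _ s.2 = (adj (dilation i) s).2); last by rewrite dilation_adj.
  by apply: IH => v h; rewrite -adjP; exact: (hs (i :: v)).
have r1 := fst0 r (hr [::]).
have r2 : r.2 = 0 by apply: l2P => w; exact: snd0.
by rewrite [r]surjective_pairing r1 r2.
Qed.

End Dilation.

(** * The defect of the characteristic function *)

Section Model.
Variables (R : realType) (n : option nat) (H : hilbertType R).
Variable T : optuple n H.
Hypothesis hT : row_contr T.
Variable Theta : {bounded fock (gen n) (defect_space T) -> fock (gen n) (defect_star_space T)}.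
Hypothesis cT : is_char_fun Theta.

Local Notation rowT := (row hT).
Local Notation colT := (col hT).
Local Notation D := (defect T).
Local Notation Ds := (defect_star T).
Local Notation DT := (defect_space T).
Local Notation F := (fock (gen n) DT).
Local Notation K := (hsum H F).
Local Notation V := (dilation T).
Local Notation oV := (dilation_orth hT).
Local Notation colV := (col (orth_row_contr oV)).
Local Notation Th := (fincl (cl_range Ds) \o Theta).

(** The projection onto the complement of the Cuntz space, in the coordinates
    given by the identification of that complement with F^2 (x) D_*. *)
Definition shift_coef : {bounded K -> fock (gen n) H} :=
  (poisson hT \o hfst H F) \+ (Th \o hsnd H F).

Lemma shift_coefE x : shift_coef x = poisson hT x.1 + Th x.2. Proof. by []. Qed.

Lemma shift_coef_nil x : shift_coef x [::] = Ds x.1 - rowT (val (x.2 [::])).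
Proof. by rewrite shift_coefE l2DE (char_fun_nil hT cT) poissonE adj_opword_nil. Qed.

Lemma shift_coef_cons i x : adj (creatb H i) (shift_coef x) = shift_coef (adj (V i) x).
Proof.
have aD y z : adj (creatb H i) (y + z) = adj (creatb H i) y + adj (creatb H i) z.
  exact: linearD.
have pD y z : poisson hT (y + z) = poisson hT y + poisson hT z by exact: linearD.
rewrite (dilation_adj hT) shift_coefE aD.
transitivity (poisson hT (adj (T i) x.1 + D (val (x.2 [::])) i) +
  Th (adj (creatb DT i) x.2)) => //.
by rewrite (poisson_adj_creat hT) (char_fun_cons hT cT) pD addrA.
Qed.

Lemma l2_dot_add (I : choiceType) (E E1 E2 : hilbertType R) (x y : l2 I E)
    (x1 y1 : l2 I E1) (x2 y2 : l2 I E2) :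
  (forall i, '[x i, y i] = '[x1 i, y1 i] + '[x2 i, y2 i]) ->
  '[x, y] = '[x1, y1] + '[x2, y2].
Proof.
move=> h; apply: l2_dot_eq.
rewrite (_ : partial_sum _ = fun A => partial_sum (fun i => '[x1 i, y1 i]) A +
  partial_sum (fun i => '[x2 i, y2 i]) A).
  exact: (cvgD (@l2_dot_cvg _ _ _ x1 y1) (@l2_dot_cvg _ _ _ x2 y2)).
by apply/funext => A; rewrite !partial_sumE -big_split; apply: eq_bigr.
Qed.

(** This combines the isometry of the defect matrix in the coordinates from H
    and the vacuum with the decomposition of the Fock space. *)
Lemma dilation_dot (x y : K) :
  '[x, y] = '[shift_coef x [::], shift_coef y [::]] + '[colV x, colV y].
Proof.
rewrite !shift_coef_nil (l2_dot_add (x1 := colT x.1 + D (val (x.2 [::])))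
  (y1 := colT y.1 + D (val (y.2 [::]))) (x2 := colS DT x.2) (y2 := colS DT y.2)).
  by rewrite addrA (halmos_isometry hT) hsum_dotE fock_dot addrA.
by move=> i; rewrite !colE !(dilation_adj hT) hsum_dotE.
Qed.

Lemma shift_coef_dot (x y : K) :
  '[shift_coef x, shift_coef y] =
  '[shift_coef x [::], shift_coef y [::]] + '[colS H (shift_coef x), colS H (shift_coef y)].
Proof. exact: fock_dot. Qed.

(** Both forms reduce to the same vacuum term and to sums over i of the same
    forms at the vectors V_i^* x and V_i^* y, and V_i^* y is orthogonal to one
    level less. *)
Lemma shift_coef_level k (y : K) : (forall m, (level V k : set K) m -> '[m, y] = 0) ->
  forall x, '[x, y] = '[shift_coef x, shift_coef y].
Proof.
elim: k y => [|k IH] y yk x.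
  have -> : y = 0 by apply: hdot_eq0; apply: yk; exact: level0.
  by rewrite (linear0 shift_coef) !hdot0r.
rewrite dilation_dot shift_coef_dot; congr (_ + _); apply: l2_dot_ext => i.
rewrite colE [colS H (shift_coef x) i]colE [colS H (shift_coef y) i]colE !shift_coef_cons.
apply: IH => m mk.
by rewrite -adjP; apply: yk; exact: level_shift.
Qed.

Lemma shift_coef_cuntz x : (cuntz_space V : set K) x -> shift_coef x = 0.
Proof.
move=> xR; apply: l2P => w; elim: w x xR => [|i w IH] x xR; last first.
  rewrite -adj_creat shift_coef_cons; apply: IH; exact: cuntz_unshift oV _ _ xR.
have /cuntz_spaceP/(_ 1%N) x1 := xR.
pose q := adj (tensb H ([::] : seq (gen n))) \o shift_coef.
suff : q x = 0 by rewrite -[LHS]/(adj _ _) adj_tensb.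
apply: (@level_ind _ _ _ V 1 (ker_subspace q)) x1 => -[//|i [|//]] y _ /=.
rewrite adj_tensb; apply: hdot_eq0; have := dilation_dot (V i y) (V i y).
rewrite (_ : colV (V i y) = tens (l2_basis i) y); last first.
  by apply: l2P => j; rewrite colE (orth_adj oV) tens_basisE.
rewrite dot_tens tens_basisE eqxx oV eqxx => /esym/eqP.
by rewrite -subr_eq0 addrK => /eqP.
Qed.

Definition cuntz_proj : {bounded K -> sub_of (cuntz_space V)} := adj (incl (cuntz_space V)).

(** Writing O for shift_coef, B = 1 - O^* O maps into every level, hence into
    the Cuntz space, and it is the identity there because O vanishes; thus B is
    the projection onto the Cuntz space. *)
Lemma cuntz_proj_dot x y : '[cuntz_proj x, cuntz_proj y] = '[x, y] - '[shift_coef x, shift_coef y].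
Proof.
pose B x := x - adj shift_coef (shift_coef x).
have BR x' : (cuntz_space V : set K) (B x').
  apply/cuntz_spaceP => k; apply: bipolar => z zk.
  by rewrite hdotBl -adjPr (shift_coef_level zk) subrr.
have cprojE x' : cuntz_proj x' = SubOf (mem_set (BR x')).
  apply: adj_uniq => r; rewrite -[RHS]/('[sub_val r, B x']) hdotBr -(adjP shift_coef).
  by rewrite (shift_coef_cuntz (set_mem (valP r))) hdot0l subr0.
rewrite {2}/cuntz_proj -(adjP (incl _)) cprojE.
by rewrite -[LHS]/('[B x, y]) hdotBl -adjPr.
Qed.

Lemma cuntz_proj_shift i x : cuntz_proj (V i x) = cuntz_part oV i (cuntz_proj x).
Proof.
apply: hdot_inj => r; rewrite -(adjPr (incl _)) (adjP (cuntz_part oV i)) -(adjPr (incl _)).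
by rewrite adjP; congr ('[_, _]); rewrite [RHS](cuntz_part_adj oV).
Qed.

Hypothesis cncT : completely_non_coisometric T.

(** For h in the Cuntz space the Parseval identity holds on each level, and
    V_w^* extends T_w^*. *)
Lemma cnc_cuntz_trivial h : (cuntz_space V : set K) (hinl H F h) -> h = 0.
Proof.
move=> hR; apply: cncT => k _.
have /cuntz_spaceP/(_ k) hk := hR.
have := level_parseval oV hk; rewrite hdot_norm.
have -> : `|hinl H F h| = `|h| by exact: hinl_isometry.
set u := partial_sum _; rewrite (_ : u = partial_sum
  (fun w : k.-tuple (gen n) => `|adj (opword T w) h| ^+ 2)) //.
rewrite /u; congr partial_sum; apply/funext => w; rewrite hdot_norm; congr (_ ^+ 2).
have aw (v : seq (gen n)) h' : adj (opword V v) (hinl H F h') = hinl H F (adj (opword T v) h').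
  elim: v h' => [|i v IH] h'; first by rewrite !adj_opword_nil.
  by rewrite !adj_opword_cons (dilation_compression hT) IH.
by rewrite aw; exact: hinl_isometry.
Qed.

Definition cuntz_proj_fock : {bounded F -> sub_of (cuntz_space V)} := cuntz_proj \o hinr H F.

(** A vector of the Cuntz space orthogonal to this range has no Fock component,
    so it lies in H and complete non-coisometry applies. *)
Lemma cuntz_proj_fock_dense r : (forall f, '[cuntz_proj_fock f, r] = 0) -> r = 0.
Proof.
move=> hr; have r2 : (sub_val r).2 = 0.
  apply: hdot_eq0; have := hr (sub_val r).2.
  by rewrite -[LHS]/('[cuntz_proj _, _]) -(adjPr (incl _)) hsum_dotE /= hdot0l add0r.
apply: val_inj => /=; have rR := set_mem (valP r).
have rE : sub_val r = hinl H F (sub_val r).1 by rewrite [LHS]surjective_pairing r2.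
by rewrite rE (cnc_cuntz_trivial (h := (sub_val r).1)) ?linear0 // -rE.
Qed.

Lemma Theta_contr f : nr (Theta f) <= nr f.
Proof. by have [h _ _] := cT; have := h f; rewrite !nrE lecR. Qed.

Lemma cuntz_proj_fock_dot f g :
  '[to_range (defect_op Theta) f, to_range (defect_op Theta) g] =
  '[cuntz_proj_fock f, cuntz_proj_fock g].
Proof.
rewrite -[LHS]/('[defect_op Theta f, defect_op Theta g]) /defect_op (op_sqrt_dot Theta_contr).
have OmR h : shift_coef (hinr H F h) = Th h.
  have p0 : poisson hT 0 = 0 by exact: linear0.
  by transitivity (poisson hT 0 + Th h) => //; rewrite p0 add0r.
rewrite -[RHS]/('[cuntz_proj _, cuntz_proj _]) cuntz_proj_dot !OmR hsum_dotE hdot0l add0r.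
by congr (_ - _); rewrite -[RHS]fock_incl_dot.
Qed.

Lemma cuntz_proj_fock_shift i f : cuntz_proj_fock (creat i f) = cuntz_part oV i (cuntz_proj_fock f).
Proof.
rewrite -[RHS]/(cuntz_part oV i (cuntz_proj (hinr H F f))) -cuntz_proj_shift.
congr (cuntz_proj _); rewrite dilationE.
transitivity ((T i 0, vacuum T (to_defect T (tensb H i 0)) + creat i f) : K) => //.
by rewrite (linear0 (T i)) (linear0 (tensb H i)) (linear0 (to_defect T)) (linear0 (vacuum T)) add0r.
Qed.

Theorem model_similar :
  (exists (W : hilbertType R) (A : optuple n W), cuntz_row_isometry A /\ jointly_similar T A) ->
  exists C : optuple n (sub_of (cl_range (defect_op Theta))),
    [/\ is_model C, row_contraction C & jointly_similar T C].
Proof.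
move=> [W [A [cA [S [S' [SK SK' ST]]]]]].
have [S1 [S1' [S1K S1K' S1T]]] := cuntz_part_similar cA SK SK' ST
  (@hinl_isometry R H F) (dilation_orth hT) (dilation_compression hT) (dilation_cyclic hT).
have [P [P' [PK P'K Pg Pdot]]] := unitary_of_dots cuntz_proj_fock_dot
  (@to_range_dense _ _ _ (defect_op Theta)) cuntz_proj_fock_dense.
pose U := cuntz_part oV.
pose C i : {bounded sub_of (cl_range (defect_op Theta)) -> sub_of (cl_range (defect_op Theta))} :=
  P' \o (U i \o P).
exists C; split.
- move=> i f; rewrite /C /=; apply: (can_inj PK); rewrite P'K.
  by rewrite !Pg cuntz_proj_fock_shift.
- apply/row_contr_contraction/orth_row_contr => i j x y.
  rewrite -Pdot -[P (C i x)]/(P (P' (U i (P x)))) -[P (C j y)]/(P (P' (U j (P y)))) !P'K.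
  by rewrite -[LHS]/('[V i (sub_val (P x)), V j (sub_val (P y))]) oV -Pdot.
- exists (P' \o S1 : {bounded H -> _}), (S1' \o P : {bounded _ -> H}); split.
  + by move=> h /=; rewrite P'K.
  + by move=> r /=; rewrite S1K'.
  + by move=> i h; rewrite /C /= P'K S1T.
Qed.

End Model.

(** * Similarity to the Cuntz part and to the model *)

Theorem corollary5p3 (R : realType) (n : option nat) (H : hilbertType R)
    (T : gen n -> {bounded H -> H}) :
  n != Some 0%N ->
  row_contraction T ->
  completely_non_coisometric T ->
  (exists (W : hilbertType R) (A : gen n -> {bounded W -> W}),
     cuntz_row_isometry A /\ jointly_similar T A) ->
  (forall (K : hilbertType R) (J : {bounded H -> K}) (V : gen n -> {bounded K -> K}),
     minimal_isometric_dilation T J V ->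
     exists U : gen n -> {bounded sub_of (cuntz_space V) -> sub_of (cuntz_space V)},
       is_cuntz_part U /\ jointly_similar T U)
  /\
  (forall Theta : {bounded fock (gen n) (defect_space T) ->
                           fock (gen n) (defect_star_space T)},
     is_char_fun Theta ->
     exists C : gen n -> {bounded sub_of (cl_range (defect_op Theta)) ->
                                  sub_of (cl_range (defect_op Theta))},
       [/\ is_model C, row_contraction C & jointly_similar T C]).
Proof.
move=> _ /row_contraction_contr hT cnc sim; split=> [K J V [iJ iV oV VJ span]|Theta cT].
  have [W [A [cA [S [S' [SK SK' ST]]]]]] := sim.
  have oV' := orth_isometriesP iV oV.
  exists (cuntz_part oV'); split; first by [].
  apply: (cuntz_part_similar cA SK SK' ST iJ oV' VJ) => r hr.
  apply: hdot_eq0.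
  have : (clspan (\bigcup_w range (fun h => opword V w (J h))) : set K) r by rewrite span.
  by apply: clspan_ortho => _ [w _ [h _ <-]]; exact: hr.
exact: (model_similar hT).
Qed.
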